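(* Let $(X,d,\mathfrak{m})$ be a metric measure space with the following properties: (1) For every $\mu_0\in\mathcal{P}_2^{ac}(X)$ and every $\mu_1\in\mathcal{P}_2(X)$, there exists $\pi\in\mathrm{OptGeo}(\mu_0,\mu_1)$ that is induced by a map from $\mu_0$. (2) There exist a point $x\in X$ and $r>0$ such that the ball $B(x,r)$ is isometric to an open interval in $\mathbb{R}$. Then $X$ is a one-dimensional manifold, possibly with boundary.
   Context: Standing conventions. A metric measure space $(X,d,\mathfrak{m})$ is a complete, locally compact and separable length space $(X,d)$ (hence geodesic) equipped with a locally finite Borel measure $\mathfrak{m}$ with $\operatorname{spt}\mathfrak{m}=X$. $B(x,r)$ denotes the open ball. $\mathrm{Geo}(X)$ is the space of constant speed, length minimising geodesics $\gamma:[0,1]\to X$, with the supremum distance; $e_t:\mathrm{Geo}(X)\to X$, $e_t(\gamma)=\gamma_t$. $\mathcal{P}(X)$ is the set of Borel probability measures on $X$; $\mathcal{P}_2(X)$ is the set of those with $\int d^2(x,x_0)\,d\mu(x)<\infty$ for some $x_0\in X$; $\mathcal{P}_2^{ac}(X)$ is the set of $\mu\in\mathcal{P}_2(X)$ absolutely continuous with respect to $\mathfrak{m}$. For $\mu_0,\mu_1\in\mathcal{P}_2(X)$, $\mathrm{Opt}(\mu_0,\mu_1)$ is the set of minimisers of $\int d^2(x,y)\,d\sigma(x,y)$ among all $\sigma\in\mathcal{P}(X\times X)$ with marginals $\mu_0$ (first) and $\mu_1$ (second), and $\mathrm{OptGeo}(\mu_0,\mu_1)$ is the set of $\pi\in\mathcal{P}(\mathrm{Geo}(X))$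 with $(e_0,e_1)_\#\pi\in\mathrm{Opt}(\mu_0,\mu_1)$. A plan $\pi\in\mathrm{OptGeo}(\mu_0,\mu_1)$ is induced by a map (from $\mu_0$) if there is a Borel map $T:X\to\mathrm{Geo}(X)$ with $\pi=T_\#\mu_0$ and $e_0\circ T=\mathrm{id}$. *)

(* Defs.v *)
From HB Require Import structures.
From mathcomp Require Import all_boot all_order all_algebra.
From mathcomp Require Import interval_inference.
From mathcomp Require Import all_classical all_reals all_analysis.

Set Implicit Arguments.
Unset Strict Implicit.
Unset Printing Implicit Defensive.

Import Order.TTheory GRing.Theory Num.Theory.
Import numFieldTopology.Exports numFieldNormedType.Exports.

Local Open Scope classical_set_scope.
Local Open Scope ring_scope.

(* Measurable types are pointed in the library, hence the pointed variants of
   [metricType]. *)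
#[short(type="pmetricType")]
HB.structure Definition PointedMetric (K : numDomainType) :=
  {M of Metric K M & isPointed M}.

#[short(type="completeMetricType")]
HB.structure Definition CompleteMetric (K : numDomainType) :=
  {M of Metric K M & Complete M}.

Notation borel X := (g_sigma_algebraType (@open X)).

Definition separable (X : topologicalType) : Prop :=
  exists2 D : set X, countable D & dense D.

Section Length.
Context {R : realType} {X : metricType R}.

Definition curve_length (g : R -> X) (a b : R) : \bar R :=
  ereal_sup [set (\sum_(0 <= i < size s)
      mdist (g (nth b (a :: s) i)) (g (nth b (a :: s) i.+1)))%:E
    | s in itv_partition a b].

(* There being no curve between two points makes the infimum [+oo], so a length
   space is path connected. *)
Definition length_space : Prop :=
  forall x y : X, (mdist x y)%:E =
    ereal_inf [set curve_length g 0 1 | g in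
      [set g : R -> X | [/\ {within `[0, 1], continuous g}, g 0 = x & g 1 = y]]].

End Length.
Arguments length_space {R} X.

Section Geodesics.
Context {R : realType}.

(* Constant speed and minimality in the usual single equation, cf. Ambrosio-Gigli,
   "A user's guide to optimal transport"; it forces continuity. *)
Record Geo (X : metricType R) := MkGeo {
  geo_fun :> {i01 R} -> X;
  geo_speed : forall s t : {i01 R}, mdist (geo_fun s) (geo_fun t) =
    `|s%:num - t%:num| * mdist (geo_fun 0%:i01) (geo_fun 1%:i01) }.

HB.instance Definition _ (X : metricType R) := gen_eqMixin (Geo X).
HB.instance Definition _ (X : metricType R) := gen_choiceMixin (Geo X).

Section GeoMetric.
Context {X : metricType R}.
Implicit Types g h k : Geo X.

Lemma geo_eqP g h : geo_fun g =1 geo_fun h -> g = h.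
Proof.
case: g h => [g gE] [h hE] /= /funext gh; subst h.
by rewrite (Prop_irrelevance gE hE).
Qed.

Definition geo_dist g h : R := sup [set mdist (g t) (h t) | t in [set: {i01 R}]].

Lemma geo_dist_has_sup g h :
  has_sup [set mdist (g t) (h t) | t in [set: {i01 R}]].
Proof.
split; first by exists (mdist (g 0%:i01) (h 0%:i01)), 0%:i01.
exists (mdist (g 0%:i01) (g 1%:i01) + mdist (g 0%:i01) (h 0%:i01)
  + mdist (h 0%:i01) (h 1%:i01)) => _ [t _ <-].
have speed (k : Geo X) : mdist (k 0%:i01) (k t) <= mdist (k 0%:i01) (k 1%:i01).
  by rewrite geo_speed ler_piMl ?mdist_ge0//= sub0r normrN ger0_norm.
apply: le_trans (metric_triangle _ (h 0%:i01) _) _; apply: lerD => //.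
apply: le_trans (metric_triangle _ (g 0%:i01) _) _; apply: lerD => //.
by rewrite metric_sym.
Qed.

Lemma geo_dist_ub g h t : mdist (g t) (h t) <= geo_dist g h.
Proof. by apply: (ub_le_sup (geo_dist_has_sup g h).2); exists t. Qed.

Lemma geo_dist_le g h (c : R) :
  (forall t, mdist (g t) (h t) <= c) -> geo_dist g h <= c.
Proof.
by move=> le_c; apply: ge_sup => [|_ [t _ <-]//]; exact: (geo_dist_has_sup g h).1.
Qed.

Let geo_distxx g : geo_dist g g = 0.
Proof.
apply/eqP; rewrite eq_le geo_dist_le => [|t]; last by rewrite mdistxx.
exact: le_trans (mdist_ge0 _ _) (geo_dist_ub g g 0%:i01).
Qed.

Let geo_dist_positivity g h : geo_dist g h = 0 -> g = h.
Proof.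
move=> gh0; apply: geo_eqP => t; apply: mdist_positivity.
by apply/eqP; rewrite eq_le mdist_ge0 -gh0 geo_dist_ub.
Qed.

Let geo_dist_sym g h : geo_dist g h = geo_dist h g.
Proof. by congr sup; under eq_fun do rewrite metric_sym. Qed.

Let geo_dist_triangle h g k : geo_dist g k <= geo_dist g h + geo_dist h k.
Proof.
apply: geo_dist_le => t; apply: le_trans (metric_triangle _ (h t) _) _.
by apply: lerD; exact: geo_dist_ub.
Qed.

HB.instance Definition _ := @isMetric.Build R (Geo X) geo_dist
  geo_distxx geo_dist_positivity geo_dist_sym geo_dist_triangle.

Definition geo_eval (t : {i01 R}) (g : Geo X) : X := g t.

Definition geo_ends (g : Geo X) : X * X := (geo_eval 0%:i01 g, geo_eval 1%:i01 g).

End GeoMetric.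

Section GeoPointed.
Context {X : pmetricType R}.

Let geo_cst_speed (s t : {i01 R}) :
  mdist (point : X) point = `|s%:num - t%:num| * mdist (point : X) point.
Proof. by rewrite mdistxx mulr0. Qed.

HB.instance Definition _ := isPointed.Build (Geo X)
  (@MkGeo X (fun=> point) geo_cst_speed).

End GeoPointed.

End Geodesics.

(* Leibniz equality would also compare the unconstrained values on nonmeasurable
   sets. *)
Definition same_law d (T : measurableType d) (R : realType)
    (mu nu : set T -> \bar R) : Prop :=
  forall A, measurable A -> mu A = nu A.

Section Measures.
Context {R : realType} {X : pmetricType R}.
Implicit Types (m : {measure set (borel X) -> \bar R})
  (mu : probability (borel X) R).

Definition locally_finite m : Prop :=
  forall x : X, exists2 r : R, 0 < r & (m (ball x r) < +oo)%E.

Definition support m : set X :=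
  [set x | forall U : set X, open U -> U x -> (0 < m U)%E].

Definition finite_second_moment mu : Prop :=
  exists x0 : X, (\int[mu]_x (mdist (x : X) x0 ^+ 2)%:E < +oo)%E.

Definition P2 : set (probability (borel X) R) :=
  [set mu | finite_second_moment mu].

Definition P2ac m : set (probability (borel X) R) :=
  [set mu | P2 mu /\ mu `<< m].

(* Plans live on the Borel sets of the product topology, which agree with the
   product sigma-algebra when [X] is separable. *)
Definition coupling (mu0 mu1 : probability (borel X) R) :
    set (probability (borel (X * X)%type) R) :=
  [set sigma |
    same_law (pushforward sigma (fst : borel (X * X)%type -> borel X)) mu0 /\
    same_law (pushforward sigma (snd : borel (X * X)%type -> borel X)) mu1].

Definition transport_cost (sigma : probability (borel (X * X)%type) R) : \bar R :=
  (\int[sigma]_p (mdist (p.1 : X) p.2 ^+ 2)%:E)%E.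

Definition Opt (mu0 mu1 : probability (borel X) R) :
    set (probability (borel (X * X)%type) R) :=
  [set sigma | coupling mu0 mu1 sigma /\
    forall tau, coupling mu0 mu1 tau ->
      (transport_cost sigma <= transport_cost tau)%E].

Definition OptGeo (mu0 mu1 : probability (borel X) R) :
    set (probability (borel (Geo X)) R) :=
  [set pi | exists2 sigma, Opt mu0 mu1 sigma &
    same_law
      (pushforward pi (geo_ends : borel (Geo X) -> borel (X * X)%type)) sigma].

Definition induced_by_map mu (pi : probability (borel (Geo X)) R) : Prop :=
  exists T : borel X -> borel (Geo X),
    [/\ measurable_fun [set: borel X] T,
        same_law pi (pushforward mu T) &
        forall x, geo_eval 0%:i01 (T x : Geo X) = x].

End Measures.

Record metric_measure_space (R : realType) (X : completeMetricType R)
    (m : {measure set (borel X) -> \bar R}) : Prop := {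
  mms_locally_compact : locally_compact [set: X];
  mms_separable : separable X;
  mms_length : length_space X;
  mms_locally_finite : locally_finite m;
  mms_support : support m = [set: X] }.

(* For the subspace metrics on [A] and [B]. *)
Definition isometric_sets (R : realType) (X Y : metricType R)
    (A : set X) (B : set Y) : Prop :=
  exists2 f : X -> Y, set_bij A B f &
    forall x y, A x -> A y -> mdist (f x) (f y) = mdist x y.

(* For the subspace topologies on [A] and [B]. *)
Definition homeomorphic_sets (S T : topologicalType)
    (A : set S) (B : set T) : Prop :=
  exists (f : S -> T) (g : T -> S),
    [/\ {within A, continuous f}, {within B, continuous g},
        forall x, A x -> B (f x) /\ g (f x) = x &
        forall y, B y -> A (g y) /\ f (g y) = y].

(* Boundary points are those sent to [0] by a chart; the boundary may be
   empty. *)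
Definition manifold1_with_boundary (R : realType) (X : topologicalType) : Prop :=
  [/\ hausdorff_space X, @second_countable X &
      forall p : X, exists (U : set X) (V : set R),
        [/\ open U, U p, open V & homeomorphic_sets U (V `&` `[0, +oo[)]].

(* Main.v *)
(* Two optimal plans that agree near their source and then separate can be
   averaged into a plan that splits every unit of mass in two.  If moreover the
   transport moves all the mass by the same distance c along the gradient of a
   1-Lipschitz function v, then by Jensen's inequality every optimal plan moves
   almost all of the mass by c along v.  A map inducing such a plan sends almost
   every source point to one of its two images, so its second marginal cannot
   charge both images of a set of source points evenly.  Hence minimal curves
   cannot branch after crossing an open set.

   Let x be the centre of a ball isometric to (-r, r).  By the above, the points
   reached from x by minimal curves that start to the right are determined by
   their distance from x, and they form a closed arm isometric to an interval;
   the same holds on the left, and the two arms cover X because minimal curves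
   into x cross the ball.  If the arms meet only at x, then X is an interval.
   Otherwise consider the first point p where they meet
   again: beyond p the two arms would coincide in an open set, and minimal curves
   from there towards x would branch at p.  So both arms end at p and X is a
   circle. *)
From HB Require Import structures.
Require Import Defs.
From mathcomp Require Import all_boot all_order all_algebra.
From mathcomp Require Import all_classical all_reals all_analysis.
From mathcomp Require Import interval_inference measurable_realfun ring lra.

Set Implicit Arguments.
Unset Strict Implicit.
Unset Printing Implicit Defensive.

Import Order.TTheory GRing.Theory Num.Theory.
Import numFieldTopology.Exports numFieldNormedType.Exports.

Local Open Scope classical_set_scope.
Local Open Scope ring_scope.

(* Makes products of pointed topological spaces pointed topological spaces. *)
HB.saturate prod.

(** * Borel measurability of continuous maps *)

Section BorelMaps.

Lemma open_borel (X : ptopologicalType) (A : set X) :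
  open A -> measurable (A : set (borel X)).
Proof. exact: sub_sigma_algebra. Qed.

Lemma closed_borel (X : ptopologicalType) (A : set X) :
  closed A -> measurable (A : set (borel X)).
Proof.
move=> cA; have /open_borel/measurableC : open (~` A) by rewrite openC.
by rewrite setCK.
Qed.

Lemma continuous_borel (X Y : ptopologicalType) (f : X -> Y) :
  continuous f -> measurable_fun [set: borel X] (f : borel X -> borel Y).
Proof.
move=> cf; apply: (measurability (@open Y : set (set (borel Y))) erefl).
move=> _ [B oB <-]; rewrite setTI; apply: open_borel.
by move/continuousP : cf; exact.
Qed.

Lemma continuous_borel_real (R : realType) (X : ptopologicalType) (f : X -> R) :
  continuous f -> measurable_fun [set: borel X] (f : borel X -> R).
Proof.
move=> cf; apply: (measurability _ (RGenOpens.measurableE R)).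
move=> _ [_ [a [b ->]] <-]; rewrite setTI; apply: open_borel.
by move/continuousP : cf; apply; exact: interval_open.
Qed.

End BorelMaps.

(** * Image laws and averages of probability measures *)

Section Laws.
Context d1 d2 (T1 : measurableType d1) (T2 : measurableType d2) (R : realType).

Lemma law_exists (mu : probability T1 R) (f : T1 -> T2) :
  measurable_fun setT f ->
  exists nu : probability T2 R, forall A, measurable A -> nu A = mu (f @^-1` A).
Proof.
move=> mf; pose F : {mfun T1 >-> T2} := HB.pack f (isMeasurableFun.Build _ _ _ _ _ mf).
by exists (distribution mu F : probability T2 R).
Qed.

Lemma midpoint_exists (mu nu : probability T1 R) :
  exists rho : probability T1 R, forall A, measurable A ->
    rho A = (2^-1%:E * (mu A + nu A))%E.
Proof.
exists (mnormalize (measure_add mu nu) mu) => A mA.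
(* [mnormalize] falls back on [mu] when the total mass is 0 or infinite; the sum has mass 2, so that
   branch is not taken. *)
transitivity ((let e := measure_add mu nu setT in
    if (e == 0) || (e == +oo%E) then fun U => mu U
    else fun U => (measure_add mu nu U * ((fine e)^-1)%:E)%E) A); first by [].
rewrite (_ : measure_add mu nu setT = (1 + 1)%:E) /=; last first.
  by rewrite measure_addE EFinD; congr (_ + _)%E; exact: probability_setT.
by rewrite eqe gt_eqF//= measure_addE muleC.
Qed.

Variables (mu : probability T1 R) (nu : probability T2 R) (f : T1 -> T2).
Hypothesis mf : measurable_fun setT f.
Hypothesis nuE : forall A, measurable A -> nu A = mu (f @^-1` A).

Lemma ge0_integral_law (h : T2 -> \bar R) : measurable_fun setT h ->
  (forall y, 0 <= h y)%E -> (\int[nu]_y h y = \int[mu]_x h (f x))%E.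
Proof.
move=> mh h0; pose F : {mfun T1 >-> T2} := HB.pack f (isMeasurableFun.Build _ _ _ _ _ mf).
rewrite (eq_measure_integral (distribution mu F)) => [|A mA _]; last exact: nuE.
by rewrite ge0_integral_distribution.
Qed.

Lemma bounded_integral_law (h : T2 -> R) (M : R) : measurable_fun setT h ->
  (forall y, `|h y| <= M) ->
  (\int[nu]_y (h y)%:E = \int[mu]_x (h (f x))%:E)%E.
Proof.
move=> mh hM; pose F : {mfun T1 >-> T2} := HB.pack f (isMeasurableFun.Build _ _ _ _ _ mf).
rewrite (eq_measure_integral (distribution mu F)) => [|A mA _]; last exact: nuE.
rewrite integral_distribution//; first exact/measurable_EFinP.
apply: (@measurable_bounded_integrable _ _ _ _ (h \o f)) => //.
- exact: le_lt_trans (probability_le1 mu measurableT) (ltry _).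
- exact: measurableT_comp.
- by exists M; split; [exact: num_real | move=> y My x _; exact: le_trans (hM _) (ltW My)].
Qed.

End Laws.

(** * Retraction of the line onto a segment *)

Section Clamp.
Context {R : realDomainType}.
Implicit Types a b s t : R.

(** Turns a curve that is isometric only on a segment into a continuous map of the whole line, and a
    Lipschitz potential into a bounded one. *)
Definition clamp a b t := Num.max a (Num.min b t).

Lemma clamp_nonexpansive a b s t : `|clamp a b s - clamp a b t| <= `|s - t|.
Proof.
suff max_nonexpansive (c u w : R) : `|Num.max c u - Num.max c w| <= `|u - w|.
  apply: le_trans (max_nonexpansive _ _ _) _.
  rewrite -[Num.min b s]opprK -[Num.min b t]opprK !oppr_min -opprD normrN.
  by apply: le_trans (max_nonexpansive _ _ _) _; rewrite -opprD normrN.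
rewrite ler_norml; case: (lerP u w) => h;
  case: (leP c u) => h1; case: (leP c w) => h2; apply/andP; split; lra.
Qed.

Lemma clamp_id a b t : a <= t <= b -> clamp a b t = t.
Proof. by move=> /andP[at_ tb]; rewrite /clamp min_r// max_r. Qed.

Lemma clamp_ge a b t : a <= clamp a b t.
Proof. by rewrite le_max lexx. Qed.

Lemma clamp_le a b t : a <= b -> clamp a b t <= b.
Proof. by move=> ab; rewrite ge_max ab ge_min lexx. Qed.

End Clamp.

(** * Continuity of distances, evaluations and nonexpansive maps *)

Section MetricContinuity.
Context {R : realType}.

Lemma ball_nonexpansive_continuous (S T : pseudoMetricType R) (f : S -> T) :
  (forall x y e, 0 < e -> ball x e y -> ball (f x) e (f y)) -> continuous f.
Proof.
move=> fe x A /nbhs_ballP[e /= e0 eA]; apply/nbhs_ballP; exists e => //= y xy.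
exact/eA/fe.
Qed.

Context {X : metricType R}.

Lemma nonexpansive_continuous (Y : metricType R) (f : Y -> X) :
  (forall x y, mdist (f x) (f y) <= mdist x y) -> continuous f.
Proof.
move=> fe; apply: ball_nonexpansive_continuous => x y e e0.
by rewrite !ballEmdist /=; exact: le_lt_trans.
Qed.

Lemma real_nonexpansive_continuous (f : X -> R) :
  (forall x y, `|f x - f y| <= mdist x y) -> continuous f.
Proof.
move=> fe; apply: ball_nonexpansive_continuous => x y e e0.
by rewrite ballEmdist /=; exact: le_lt_trans.
Qed.

Lemma curve_nonexpansive_continuous (f : R -> X) :
  (forall s t, mdist (f s) (f t) <= `|s - t|) -> continuous f.
Proof.
move=> fe; apply: ball_nonexpansive_continuous => x y e e0.
by rewrite ballEmdist /=; exact: le_lt_trans.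
Qed.

Lemma mdist_reverse_triangle (x y z : X) : `|mdist x y - mdist x z| <= mdist y z.
Proof.
have := metric_triangle x y z; have := metric_triangle x z y.
by rewrite (metric_sym z y) ler_norml => h1 h2; apply/andP; split; lra.
Qed.

Lemma mdist_continuous (x : X) : continuous (mdist x : X -> R).
Proof.
by apply: real_nonexpansive_continuous => y z; exact: mdist_reverse_triangle.
Qed.

Lemma mdist_ball_open (x : X) (r : R) : open (ball x r).
Proof.
rewrite ballEmdist; have /continuousP := @mdist_continuous x.
by move=> /(_ [set y | y < r]); apply; exact: open_lt.
Qed.

Lemma continuous_mdist2 : continuous (fun p : X * X => mdist p.1 p.2 : R).
Proof.
move=> [x y] A /nbhs_ballP[e /= e0 eA]; apply/nbhs_ballP; exists (e / 2) => /=.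
  by rewrite divr_gt0.
move=> [x' y'] [/=]; rewrite !ballEmdist /= => xx' yy'.
apply: eA; rewrite /ball/=.
have := mdist_reverse_triangle y x x'; have := mdist_reverse_triangle x' y y'.
rewrite (metric_sym y x) (metric_sym y x') !ler_norml ltr_norml /= => /andP[h1 h2] /andP[h3 h4].
by apply/andP; split; lra.
Qed.

Lemma geo_eval_continuous (t : {i01 R}) : continuous (geo_eval t : Geo X -> X).
Proof. by apply: nonexpansive_continuous => g h; exact: geo_dist_ub. Qed.

Lemma geo_ends_continuous : continuous (@geo_ends R X).
Proof.
move=> g; apply: (@cvg_pair _ _ _ (nbhs g) (nbhs (g 0%:i01)) (nbhs (g 1%:i01)));
  exact: geo_eval_continuous.
Qed.

End MetricContinuity.

(** * Transport maps from induced plans *)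

Section Transport.
Context {R : realType} {X : pmetricType R}.
Implicit Types mu nu : probability (borel X) R.

Lemma measurable_cost :
  measurable_fun setT (fun p : borel (X * X)%type => (mdist (p.1 : X) p.2 ^+ 2)%:E).
Proof.
apply/measurable_EFinP.
have := continuous_borel_real (@continuous_mdist2 R X).
exact: measurable_funX.
Qed.

(** The law of [geo_ends (T x)] is the optimal coupling behind [pi]; as [T x] starts at [x], its
    cost is the cost of the map [S]. *)
Lemma optimal_map mu nu pi : OptGeo mu nu pi -> induced_by_map mu pi ->
  exists T : X -> Geo X, let S x := geo_eval 1%:i01 (T x) in
  [/\ forall x, T x 0%:i01 = x,
      measurable_fun [set: borel X] (S : borel X -> borel X),
      measurable_fun setT ((fun x => mdist x (S x)) : borel X -> R),
      forall A : set (borel X), measurable A -> nu A = mu (S @^-1` A) &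
      forall sigma, coupling mu nu sigma ->
        (\int[mu]_x (mdist x (S x) ^+ 2)%:E <= transport_cost sigma)%E].
Proof.
move=> [tau [[_ tau2] tau_opt] pi_tau] [T [mT piT T0]]; exists T => S.
have mends : measurable_fun setT (geo_ends : borel (Geo X) -> borel (X * X)%type).
  by apply: continuous_borel; exact: geo_ends_continuous.
have mS : measurable_fun [set: borel X] (S : borel X -> borel X).
  have mev t : measurable_fun setT (geo_eval t : borel (Geo X) -> borel X).
    by apply: continuous_borel; exact: geo_eval_continuous.
  exact: measurableT_comp (mev _) mT.
have tauE A : measurable A -> tau A = mu ((fun x => geo_ends (T x)) @^-1` A).
  move=> mA; rewrite -(pi_tau A mA) /pushforward piT//.
  by rewrite -[X in measurable X]setTI; exact: mends.
split=> //.
- have md := continuous_borel_real (@continuous_mdist2 R X).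
  apply: eq_measurable_fun (measurableT_comp md (measurableT_comp mends mT)).
  by move=> x _; rewrite /= T0.
- move=> A mA; rewrite -(tau2 A mA) /pushforward tauE//.
  rewrite -[X in measurable X]setTI.
  by apply: (@continuous_borel (X * X)%type X snd) => // ?; exact: cvg_snd.
- move=> sigma /tau_opt; apply: le_trans; rewrite /transport_cost.
  rewrite (ge0_integral_law (measurableT_comp mends mT) tauE) /=.
  + by rewrite le_eqVlt; apply/orP; left; apply/eqP/eq_integral => x _; rewrite /= T0.
  + exact: measurable_cost.
  + by move=> p; rewrite lee_fin sqr_ge0.
Qed.

End Transport.

(** * Almost sure statements under a probability measure *)

Section AlmostEverywhere.
Context d (T : measurableType d) (R : realType) (mu : probability T R).

(* On Borel spaces, instance resolution fails to find the almost everywhere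
   filter. *)
Lemma ae_and (P Q : T -> Prop) : {ae mu, forall x, P x} -> {ae mu, forall x, Q x} ->
  {ae mu, forall x, P x /\ Q x}.
Proof. by move=> aeP aeQ; apply: filterS2 aeP aeQ => x. Qed.

Lemma ae_impl (P Q : T -> Prop) : (forall x, P x -> Q x) ->
  {ae mu, forall x, P x} -> {ae mu, forall x, Q x}.
Proof. by move=> PQ; apply: filterS. Qed.

Lemma ae_exists (P : T -> Prop) : {ae mu, forall x, P x} -> exists x, P x.
Proof.
move=> [N [mN N0 PN]]; apply: contrapT => nP.
suff : mu setT = 0%E by rewrite probability_setT => /eqP; rewrite onee_eq0.
apply/eqP; rewrite -measure_le0 -N0; apply: le_measure; rewrite ?inE// => x _.
by apply: PN => /= Px; apply: nP; exists x.
Qed.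

Lemma prob1_ae (A : set T) : measurable A -> mu A = 1%E -> {ae mu, forall x, A x}.
Proof.
move=> mA muA; exists (~` A); split => //; first exact: measurableC.
by rewrite probability_setC// muA subee.
Qed.

Lemma le_measure_setU_null (A B N : set T) : measurable A -> measurable B ->
  measurable N -> mu N = 0%E -> A `<=` B `|` N -> (mu A <= mu B)%E.
Proof.
move=> mA mB mN N0 AB; apply: (@le_trans _ _ (mu (B `|` N))).
  by apply: le_measure; rewrite ?inE//; exact: measurableU.
apply: le_trans (measureU2 _ mB mN) _.
by rewrite [X in (_ + X)%E](_ : _ = 0%E) ?adde0.
Qed.

Lemma ae_prob1 (A : set T) : measurable A -> {ae mu, forall x, A x} -> mu A = 1%E.
Proof.
move=> mA [N [mN N0 AN]]; apply/eqP; rewrite eq_le probability_le1//=.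
rewrite -(probability_setT mu); apply: le_measure_setU_null N0 _ => //.
by move=> x _; have [|nA] := pselect (A x); [left | right; exact: AN].
Qed.

Lemma ae_le_measure (A B : set T) : measurable A -> measurable B ->
  {ae mu, forall x, A x -> B x} -> (mu A <= mu B)%E.
Proof.
move=> mA mB [N [mN N0 AN]]; apply: le_measure_setU_null N0 _ => // x Ax.
by have [|nB] := pselect (B x); [left | right; apply: AN => /(_ Ax)].
Qed.

Lemma ae_eq_measure (A B : set T) : measurable A -> measurable B ->
  {ae mu, forall x, A x <-> B x} -> mu A = mu B.
Proof.
move=> mA mB AB; apply/eqP; rewrite eq_le.
by apply/andP; split; apply: ae_le_measure => //; apply: filterS AB => x [].
Qed.

Lemma ge0_integral_le_cst (f : T -> R) (c : R) : measurable_fun setT f ->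
  (forall x, 0 <= f x) -> {ae mu, forall x, f x <= c} ->
  (\int[mu]_x (f x)%:E <= c%:E)%E.
Proof.
move=> mf f0 [N [mN N0 fN]]; have c0 : 0 <= c.
  have [|x fx] := @ae_exists (fun x => f x <= c); last exact: le_trans (f0 x) fx.
  by exists N.
rewrite -[leRHS]mule1 -(probability_setT mu) -integral_cst//.
apply: ae_ge0_le_integral => //.
- by move=> x _; rewrite lee_fin.
- exact/measurable_EFinP.
- exists N; split => // x /=; apply: contra_notP => Nx _.
  by rewrite lee_fin; apply: contrapT => /fN.
Qed.

Lemma bounded_probability_integrable (f : T -> R) (M : R) :
  measurable_fun setT f -> (forall x, `|f x| <= M) -> mu.-integrable setT (EFin \o f).
Proof.
move=> mf fM; apply: measurable_bounded_integrable => //.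
  exact: le_lt_trans (probability_le1 mu measurableT) (ltry _).
by exists M; split; [exact: num_real | move=> y My x _; exact: le_trans (fM _) (ltW My)].
Qed.

(* [E (D + c)^2 = E D^2 + c^2] when [E D = 0]. *)
Lemma centered_ae0 (D : T -> R) (M c : R) : measurable_fun setT D ->
  (forall x, `|D x| <= M) -> (\int[mu]_x (D x)%:E = 0)%E ->
  (\int[mu]_x ((D x + c) ^+ 2)%:E <= (c ^+ 2)%:E)%E -> {ae mu, forall x, D x = 0}.
Proof.
move=> mD DM D0 Dc.
have iD := bounded_probability_integrable mD DM.
have mD2 : measurable_fun setT (fun x => D x ^+ 2) by exact: measurable_funX.
have iD2 : mu.-integrable setT (EFin \o (fun x => D x ^+ 2)).
  apply: (@bounded_probability_integrable _ (M ^+ 2)) => // x.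
  by rewrite normrX lerXn2r// nnegrE (le_trans _ (DM x)).
have ic : mu.-integrable setT (EFin \o cst (c ^+ 2)).
  by apply: (@bounded_probability_integrable _ `|c ^+ 2|).
have iDc : mu.-integrable setT (fun x => (c *+ 2)%:E * (D x)%:E)%E by exact: integrableZl.
move: Dc.
have -> : (\int[mu]_x ((D x + c) ^+ 2)%:E = \int[mu]_x (D x ^+ 2)%:E + (c ^+ 2)%:E)%E.
  transitivity (\int[mu]_x (((D x ^+ 2)%:E + (c *+ 2)%:E * (D x)%:E) + (c ^+ 2)%:E))%E.
    by apply: eq_integral => x _; rewrite -EFinM -!EFinD; congr (_%:E); ring.
  rewrite integralD//; last exact: integrableD.
  rewrite integralD// integralZl// D0 mule0 adde0 integral_cst//.
  by rewrite [X in (_ * X)%E](probability_setT mu) mule1.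
rewrite -leeBrDr// subee// => D2.
have {}D2 : (\int[mu]_x `|(D x ^+ 2)%:E| = 0)%E.
  apply/eqP; rewrite eq_le integral_ge0// andbT; apply: le_trans D2.
  by rewrite le_eqVlt; apply/orP; left; apply/eqP/eq_integral => x _; rewrite gee0_abs// lee_fin sqr_ge0.
have /ae_eq_integral_abs := D2 => /(_ measurableT) [|N [mN N0 DN]].
  exact/measurable_EFinP.
exists N; split => // x /=; apply: contra_notP => Nx; apply/eqP.
rewrite -sqrf_eq0; apply/eqP/EFin_inj; apply: contrapT => Dx0.
by apply/Nx/DN => /= /(_ Logic.I).
Qed.

End AlmostEverywhere.

(** * Optimal maps from open sets and the exclusion of branching *)

Section OptimalTransport.
Context {R : realType} {X : pmetricType R} (m : {measure set (borel X) -> \bar R}).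
Hypothesis m_locally_finite : locally_finite m.
Hypothesis m_support : Defs.support m = [set: X].

Lemma borel_ball (a : X) (r : R) : measurable (ball a r : set (borel X)).
Proof.
by apply: open_borel; exact: mdist_ball_open.
Qed.

Lemma P2_of_bounded (mu : probability (borel X) R) (a : X) (r : R) :
  mu (ball a r) = 1%E -> P2 mu.
Proof.
move=> mu1; exists a; apply: (@le_lt_trans _ _ (r ^+ 2)%:E); last exact: ltry.
have mda : measurable_fun setT ((fun x => mdist x a) : borel X -> R).
  apply: continuous_borel_real; under eq_fun do rewrite metric_sym.
  exact: mdist_continuous.
apply: ge0_integral_le_cst => [|x|]; [exact: measurable_funX|exact: sqr_ge0|].
apply: ae_impl (prob1_ae (borel_ball a r) mu1) => x; rewrite ballEmdist /= => xr.
rewrite metric_sym lerXn2r ?nnegrE ?mdist_ge0 ?ltW//.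
exact: le_lt_trans (mdist_ge0 _ _) xr.
Qed.

(** Normalises the restriction of [m] to a ball: local finiteness makes its mass finite, full
    support makes it positive. *)
Lemma uniform_on_small_ball (A : set X) (a : X) : open A -> A a ->
  exists (mu : probability (borel X) R) (r : R),
    [/\ 0 < r, ball a r `<=` A, mu (ball a r) = 1%E & P2ac m mu].
Proof.
move=> oA Aa; have [r0 r0_gt0 mr0] := m_locally_finite a.
have /nbhs_ballP[r1 /= r1_gt0 r1A] : nbhs a A by exact: open_nbhs_nbhs.
pose r := Num.min r0 r1; have r_gt0 : 0 < r by rewrite lt_min r0_gt0.
have mB := borel_ball a r.
pose mu : probability (borel X) R := mnormalize (mrestr m mB) (dirac (a : borel X)).
have muE E : mu E = (m (E `&` ball a r) * ((fine (m (ball a r)))^-1)%:E)%E.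
  transitivity ((let e := m (setT `&` ball a r) in
      if (e == 0) || (e == +oo%E) then fun U => dirac (a : borel X) U
      else fun U => (m (U `&` ball a r) * ((fine e)^-1)%:E)%E) E); first by [].
  rewrite setTI /= ifF//; apply/negbTE; rewrite negb_or; apply/andP; split.
    rewrite gt_eqF//; have : Defs.support m a by rewrite m_support.
    by apply; [exact: mdist_ball_open|exact: ballxx].
  rewrite lt_eqF//; apply: le_lt_trans mr0; apply: le_measure; rewrite ?inE//.
    exact: borel_ball.
  by apply: le_ball; rewrite ge_min lexx.
have mu1 : mu (ball a r) = 1%E.
  have := probability_setT mu; rewrite !muE setTI setIid.
  by [].
exists mu, r; split=> //.
  by apply: subset_trans r1A; apply: le_ball; rewrite ge_min lexx orbT.
split; first exact: P2_of_bounded mu1.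
move=> N mN B mB' BN; rewrite muE.
have -> : m (B `&` ball a r) = 0%E.
  by apply: mN; [exact: measurableI | move=> x [/BN]].
by rewrite mul0e.
Qed.

Hypothesis maps : forall mu0 mu1 : probability (borel X) R, P2ac m mu0 -> P2 mu1 ->
  exists2 pi, OptGeo mu0 mu1 pi & induced_by_map mu0 pi.

(** Transporting a measure carried by a small ball to the Dirac mass at [z] joins almost every point
    of the ball to [z]. *)
Lemma geodesic_from_open_set (A : set X) (a z : X) : open A -> A a ->
  exists g : Geo X, A (g 0%:i01) /\ g 1%:i01 = z.
Proof.
move=> oA Aa; have [mu [r [r0 rA mur muac]]] := uniform_on_small_ball oA Aa.
pose nu : probability (borel X) R := dirac (z : borel X).
have nuP2 : P2 nu.
  by apply: (@P2_of_bounded _ z 1); rewrite /nu/= diracE mem_set//; exact: ballxx.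
have [pi piO piT] := maps muac nuP2.
have [T [T0 mS _ nuE _]] := optimal_map piO piT.
have mz : measurable ([set z] : set (borel X)).
  by apply: closed_borel; exact/accessible_closed_set1/hausdorff_accessible/metric_hausdorff.
have mSz : measurable ((fun x : borel X => geo_eval 1%:i01 (T x)) @^-1` [set z]).
  by rewrite -[X in measurable X]setTI; exact: mS.
have muSz : mu ((fun x : borel X => geo_eval 1%:i01 (T x)) @^-1` [set z]) = 1%E.
  by rewrite -nuE// /nu/= diracE mem_set.
have [x [Bx Sx]] : exists x, ball a r x /\ geo_eval 1%:i01 (T x) = z.
  exact: ae_exists (ae_and (prob1_ae (borel_ball a r) mur) (prob1_ae mSz muSz)).
by exists (T x); rewrite T0; split=> //; exact: rA.
Qed.

(* Branching of the gradient lines of [v]: [p1] and [p2] follow two of them for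
   time [c], and [psi] follows them back. *)
Lemma no_branching (A K : set X) (a0 : X) (v : X -> R) (p1 p2 psi : X -> X) (c : R) :
  open A -> A a0 -> closed K ->
  (forall x y, `|v x - v y| <= mdist x y) ->
  continuous p1 -> continuous p2 -> continuous psi ->
  (forall a b, A a -> A b -> v a = v b -> a = b) ->
  (forall a, A a ->
    [/\ mdist a (p1 a) <= c, v (p1 a) = v a + c, psi (p1 a) = a & K (p1 a)]) ->
  (forall a, A a ->
    [/\ mdist a (p2 a) <= c, v (p2 a) = v a + c, psi (p2 a) = a & ~ K (p2 a)]) ->
  False.
Proof.
move=> oA Aa0 cK v_lip cp1 cp2 cpsi v_inj p1P p2P.
have [mu [r [r0 rA muB muac]]] := uniform_on_small_ball oA Aa0.
set B := ball a0 r in rA muB; have mB : measurable (B : set (borel X)) := borel_ball a0 r.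
have aeB := prob1_ae mB muB.
have Ba0 : B a0 by exact: ballxx.
have c0 : 0 <= c by have [+ _ _ _] := p1P _ Aa0; apply: le_trans; exact: mdist_ge0.
have mpre (f : X -> X) (E : set (borel X)) :
    measurable_fun setT (f : borel X -> borel X) -> measurable E ->
    measurable (f @^-1` E : set (borel X)).
  by move=> mf mE; rewrite -[X in measurable X]setTI; exact: mf.
have mp1 := continuous_borel cp1; have mp2 := continuous_borel cp2.
have mpsi := continuous_borel cpsi.
(* On [B] the values of [v] lie within [r] of [v a0], and the transport adds at most [c]. So [b]
   agrees with [v] wherever it matters, and it is bounded, hence integrable. *)
pose lo := v a0 - r; pose hi := v a0 + r + c.
have lohi : lo <= hi by rewrite /lo /hi; lra.
pose b x := clamp lo hi (v x).
have bM x : `|b x| <= `|v a0| + r + c.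
  have := ler_norm (v a0); have := ler_norm (- v a0).
  have := clamp_ge lo hi (v x); have := clamp_le (v x) lohi.
  by rewrite normrN ler_norml /b /lo /hi => h1 h2 h3 h4; apply/andP; split; lra.
have b_lip x y : `|b x - b y| <= mdist x y.
  exact: le_trans (clamp_nonexpansive _ _ _ _) (v_lip x y).
have bBc x y (c' : R) : B x -> 0 <= c' <= c -> v y = v x + c' -> b y = v x + c'.
  rewrite /B ballEmdist /= => xr /andP[h1 h2] vy.
  have := v_lip a0 x; rewrite ler_norml => /andP[h3 h4].
  by rewrite /b clamp_id// /lo /hi vy; apply/andP; split; lra.
have bB x : B x -> b x = v x.
  by move=> Bx; rewrite (bBc x x 0) ?addr0// lexx.
have mb : measurable_fun setT (b : borel X -> R).
  by apply: continuous_borel_real; exact: real_nonexpansive_continuous.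
(* The target [nu] receives half of the mass along [p1] and half along [p2]. *)
have [nu1 nu1E] := law_exists mu mp1; have [nu2 nu2E] := law_exists mu mp2.
have [nu nuE] := midpoint_exists nu1 nu2.
have {}nuE (E : set (borel X)) : measurable E -> nu E = (2^-1%:E * (mu (p1 @^-1` E) + mu (p2 @^-1` E)))%E.
  by move=> mE; rewrite nuE// nu1E// nu2E.
have half2 (x : \bar R) : x \is a fin_num -> (2^-1%:E * (x + x))%E = x.
  by case: x => // x _; rewrite -EFinD -EFinM; congr _%:E; lra.
have mufin (E : set (borel X)) : measurable E -> mu E \is a fin_num by move=> mE; exact: fin_num_measure.
have nu_full (E : set (borel X)) : measurable E -> (forall x, B x -> E (p1 x)) ->
    (forall x, B x -> E (p2 x)) -> nu E = 1%E.
  move=> mE E1 E2; rewrite nuE//.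
  have -> : mu (p1 @^-1` E) = 1%E by apply: ae_prob1; [exact: mpre|exact: ae_impl aeB].
  have -> : mu (p2 @^-1` E) = 1%E by apply: ae_prob1; [exact: mpre|exact: ae_impl aeB].
  exact: half2.
have nuP2 : P2 nu.
  apply: (@P2_of_bounded _ a0 (r + c)); apply: nu_full; first exact: borel_ball.
  - move=> x Bx; have [+ _ _ _] := p1P _ (rA _ Bx); move: Bx; rewrite /B !ballEmdist /= => h1 h2.
    by have := metric_triangle a0 x (p1 x); lra.
  - move=> x Bx; have [+ _ _ _] := p2P _ (rA _ Bx); move: Bx; rewrite /B !ballEmdist /= => h1 h2.
    by have := metric_triangle a0 x (p2 x); lra.
have [pi piO piT] := maps muac nuP2.
have [T [_ + mdS muS + ]] := optimal_map piO piT.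
set S := fun x : X => geo_eval 1%:i01 (T x) => mS cost_le.
have mSpre := mpre _ _ mS.
(* The competitor is the average of the couplings carried by the graphs of [p1] and [p2], which
   moves nothing farther than [c]. *)
have cost_S : (\int[mu]_x (mdist x (S x) ^+ 2)%:E <= (c ^+ 2)%:E)%E.
  have mid f : continuous f ->
      measurable_fun setT ((fun x : X => (x, f x)) : borel X -> borel (X * X)%type).
    move=> cf; apply: (@continuous_borel X (X * X)%type (fun x => (x, f x))) => x.
    by apply: cvg_pair; [exact: cvg_id|exact: cf].
  have [s1 s1E] := law_exists mu (mid _ cp1); have [s2 s2E] := law_exists mu (mid _ cp2).
  have [s sE] := midpoint_exists s1 s2.
  have mfst : measurable_fun setT (fst : borel (X * X)%type -> borel X).
    by apply: continuous_borel => ?; exact: cvg_fst.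
  have msnd : measurable_fun setT (snd : borel (X * X)%type -> borel X).
    by apply: continuous_borel => ?; exact: cvg_snd.
  apply: (@le_trans _ _ (transport_cost s)).
    apply: cost_le; split=> E mE; rewrite /pushforward.
    + have mfE : measurable (fst @^-1` E : set (borel (X * X)%type)).
        by rewrite -[X in measurable X]setTI; exact: mfst.
      by rewrite sE// s1E// s2E//; apply: half2; exact: mufin.
    + have mfE : measurable (snd @^-1` E : set (borel (X * X)%type)).
        by rewrite -[X in measurable X]setTI; exact: msnd.
      by rewrite sE// s1E// s2E// nuE.
  have md := continuous_borel_real (@continuous_mdist2 R X).
  apply: ge0_integral_le_cst => [|p|]; [exact: measurable_funX|exact: sqr_ge0|].
  have mdc : measurable ([set p | mdist p.1 p.2 <= c] : set (borel (X * X)%type)).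
    rewrite [X in measurable X](_ : _ = setT `&` (fun p : borel (X * X)%type => mdist (p.1 : X) p.2) @^-1` `]-oo, c]).
      exact: md.
    by rewrite setTI; apply/seteqP; split => p /=; rewrite in_itv.
  apply: (@ae_impl _ _ _ _ (fun p : borel (X * X)%type => mdist (p.1 : X) p.2 <= c)).
    by move=> p pc; rewrite lerXn2r// nnegrE// mdist_ge0.
  apply: (prob1_ae mdc); rewrite sE// s1E// s2E//.
  have mdf f : continuous f -> measurable ((fun x : X => (x, f x)) @^-1` [set p | mdist p.1 p.2 <= c] : set (borel X)).
    by move=> cf; rewrite -[X in measurable X]setTI; exact: mid.
  have -> : mu ((fun x : X => (x, p1 x)) @^-1` [set p | mdist p.1 p.2 <= c]) = 1%E.
    apply: ae_prob1; first exact: mdf.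
    by apply: ae_impl aeB => x /rA /p1P[].
  have -> : mu ((fun x : X => (x, p2 x)) @^-1` [set p | mdist p.1 p.2 <= c]) = 1%E.
    apply: ae_prob1; first exact: mdf.
    by apply: ae_impl aeB => x /rA /p2P[].
  exact: half2.
pose theta x := psi (S x).
have mtheta : measurable_fun setT (theta : borel X -> borel X) := measurableT_comp mpsi mS.
(* Transporting by [S] and flowing back preserves [mu], because [psi] undoes both [p1] and [p2]. *)
have mu_theta (E : set (borel X)) : measurable E -> mu E = mu (theta @^-1` E).
  move=> mE; rewrite -[RHS]/(mu (S @^-1` (psi @^-1` E))) -muS ?nuE; [|exact: mpre..].
  have -> : mu (p1 @^-1` (psi @^-1` E)) = mu E.
    apply: ae_eq_measure => //; first by apply: (mpre) => //; exact: mpre.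
    by apply: ae_impl aeB => x /rA /p1P[_ _ + _]; rewrite /= => ->.
  have -> : mu (p2 @^-1` (psi @^-1` E)) = mu E.
    apply: ae_eq_measure => //; first by apply: (mpre) => //; exact: mpre.
    by apply: ae_impl aeB => x /rA /p2P[_ _ + _]; rewrite /= => ->.
  by rewrite half2// mufin.
have mbpsi : measurable_fun setT ((b \o psi) : borel X -> R) := measurableT_comp mb mpsi.
(* [nu] is carried by the points [y] with [psi y] in [B] and [b y = b (psi y) + c], and [S] sends
   [mu] to [nu]. *)
have aeG : {ae mu, forall x, B (theta x) /\ b (S x) = b (theta x) + c}.
  have mG1 : measurable (psi @^-1` B : set (borel X)) by exact: mpre.
  have mG2 : measurable ([set y | b y - b (psi y) = c] : set (borel X)).
    have /(_ measurableT _ (measurable_set1 c)) := measurable_funB mb mbpsi.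
    by rewrite setTI.
  have mG := measurableI _ _ mG1 mG2.
  have muG : mu (S @^-1` (psi @^-1` B `&` [set y | b y - b (psi y) = c])) = 1%E.
    rewrite -muS//; apply: nu_full => // x Bx.
      have [_ vx px _] := p1P _ (rA _ Bx); split; rewrite /= px// (bBc x _ c)// ?c0 ?lexx// bB//.
      by rewrite addrAC subrr add0r.
    have [_ vx px _] := p2P _ (rA _ Bx); split; rewrite /= px// (bBc x _ c)// ?c0 ?lexx// bB//.
    by rewrite addrAC subrr add0r.
  apply: ae_impl (prob1_ae (mSpre _ mG) muG) => x [/= Bx bx]; split=> //.
  by rewrite /theta -bx addrC subrK.
pose D x := b (theta x) - b x.
have mbt : measurable_fun setT ((b \o theta) : borel X -> R) := measurableT_comp mb mtheta.
have mD : measurable_fun setT (D : borel X -> R) by exact: measurable_funB.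
have intD : (\int[mu]_x (D x)%:E = 0)%E.
  have ib := bounded_probability_integrable mu mb bM.
  have ibt := bounded_probability_integrable mu mbt (fun x => bM (theta x)).
  rewrite (integralB_EFin measurableT ibt ib) -(bounded_integral_law mtheta mu_theta mb bM).
  by rewrite subee//; exact: integrable_fin_num ib.
(* Almost everywhere [D x + c = b (S x) - b x], which is at most [mdist x (S x)] in absolute value.
   Its square thus has integral at most [c ^+ 2], while [D] has mean zero: the equality case of
   Jensen. *)
have D0 : {ae mu, forall x, D x = 0}.
  apply: (@centered_ae0 _ _ _ mu D (`|v a0| + r + c + (`|v a0| + r + c)) c) => //.
    by move=> x; apply: le_trans (ler_normB _ _) _; apply: lerD.
  apply: le_trans cost_S; apply: ae_ge0_le_integral => //.
  - by move=> x _; rewrite lee_fin sqr_ge0.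
  - apply/measurable_EFinP/measurable_funX; exact: measurable_funD.
  - by move=> x _; rewrite lee_fin sqr_ge0.
  - by apply/measurable_EFinP; exact: measurable_funX.
  - apply: ae_impl aeG => x [_ bS] _; rewrite lee_fin -[leRHS]real_normK ?num_real//.
    rewrite -[leLHS]real_normK ?num_real// lerXn2r ?nnegrE ?normr_ge0//.
    rewrite [leRHS]ger0_norm ?mdist_ge0//; apply: le_trans (b_lip _ _).
    by rewrite distrC bS /D addrAC.
(* [theta x] and [x] have the same potential, and [v] is injective on [A]: [S x] is reached by
   flowing from [x] itself. *)
have aeT : {ae mu, forall x, B x /\ theta x = x}.
  apply: ae_impl (ae_and aeB (ae_and D0 aeG)) => x [Bx [Dx [Btx _]]]; split=> //.
  apply: v_inj; [exact: rA|exact: rA|].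
  by rewrite -bB// -(bB x)//; apply/eqP; rewrite -subr_eq0; apply/eqP.
have mK := closed_borel cK.
(* [K] contains the images under [p1] and misses those under [p2], so exactly half of the mass
   starting in any [E] ends in [K]. *)
have half_mu (E : set (borel X)) : measurable E -> mu (E `&` S @^-1` K) = (2^-1%:E * mu E)%E.
  move=> mE; have mpE : measurable (psi @^-1` E : set (borel X)) by exact: mpre.
  have mpEK := measurableI _ _ mpE mK.
  transitivity (nu (psi @^-1` E `&` K)).
    rewrite muS//; apply: ae_eq_measure; [by apply: measurableI => //; exact: mSpre|exact: mSpre|].
    by apply: ae_impl aeT => x [Bx tx] /=; rewrite -[psi (S x)]/(theta x) tx.
  rewrite nuE//; congr (_ * _)%E.
  have -> : mu (p1 @^-1` (psi @^-1` E `&` K)) = mu E.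
    apply: ae_eq_measure => //; first exact: mpre.
    by apply: ae_impl aeB => x /rA /p1P[_ _ + Kx]; rewrite /= => ->; split => // -[].
  have -> : mu (p2 @^-1` (psi @^-1` E `&` K)) = mu set0.
    apply: ae_eq_measure => //; first exact: mpre.
    apply: ae_impl aeB => x Bx; have [_ _ _ Kx] := p2P _ (rA _ Bx).
    by split => // -[].
  by rewrite measure0 adde0.
have mSK : measurable (S @^-1` K : set (borel X)) by exact: mSpre.
(* The set of points sent into [K] would have mass 1/2, and also half of its own mass. *)
have := half_mu _ mSK; have := half_mu setT measurableT.
rewrite setTI setIid => ->; rewrite probability_setT mule1 -EFinM => /eqP.
by rewrite eqe => /eqP; lra.
Qed.

End OptimalTransport.

(** * Minimal curves of unit speed *)

Section IsometricCurves.
Context {R : realType} {X : metricType R}.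

Definition isometric_on (L : R) (g : R -> X) : Prop :=
  forall s t, 0 <= s -> s <= t -> t <= L -> mdist (g s) (g t) = t - s.

Lemma isometric_onW (L L' : R) (g : R -> X) :
  L' <= L -> isometric_on L g -> isometric_on L' g.
Proof. by move=> LL' gL s t s0 st tL; apply: gL => //; exact: le_trans LL'. Qed.

Lemma isometric_on_dist (L : R) (g : R -> X) (s t : R) : isometric_on L g ->
  0 <= s <= L -> 0 <= t <= L -> mdist (g s) (g t) = `|s - t|.
Proof.
move=> gL /andP[s0 sL] /andP[t0 tL]; have [st|/ltW ts] := lerP s t.
  exact: gL.
by rewrite metric_sym; exact: gL.
Qed.

Lemma isometric_on_clamp_continuous (L : R) (g : R -> X) : 0 <= L ->
  isometric_on L g -> continuous (fun s => g (clamp 0 L s)).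
Proof.
move=> L0 gL; apply: curve_nonexpansive_continuous => s t.
rewrite (isometric_on_dist gL); first exact: clamp_nonexpansive.
- by rewrite clamp_ge clamp_le.
- by rewrite clamp_ge clamp_le.
Qed.

Lemma geo_isometric (h : Geo X) : exists g : R -> X,
  [/\ isometric_on (mdist (h 0%:i01) (h 1%:i01)) g, g 0 = h 0%:i01 &
      g (mdist (h 0%:i01) (h 1%:i01)) = h 1%:i01].
Proof.
set L := mdist _ _; have L0 : 0 <= L by exact: mdist_ge0.
(* Arc length parametrisation; the clamp gives a legal parameter for every [u], also when [L = 0]
   and the geodesic is constant. *)
pose c (u : R) : {i01 R} := Itv01 (clamp_ge 0 1 (u / L)) (clamp_le (u / L) ler01).
have hE (s t : {i01 R}) : s%:num = t%:num -> h s = h t.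
  by move=> st; congr (geo_fun h _); exact: val_inj.
exists (h \o c).
have [L_eq0|L_neq0] := eqVneq L 0.
  have e01 : h 0%:i01 = h 1%:i01 by apply: mdist_positivity.
  have hc t : h t = h 0%:i01.
    by apply: mdist_positivity; rewrite geo_speed -/L L_eq0 mulr0.
  split=> [s t s0 st tL||]; rewrite /= ?hc -?e01//.
  by rewrite mdistxx; rewrite L_eq0 in tL; lra.
have cE u : 0 <= u <= L -> (c u)%:num = u / L.
  move=> /andP[u0 uL]; rewrite /= clamp_id// divr_ge0//=.
  by rewrite ler_pdivrMr ?mul1r// lt_neqAle eq_sym L_neq0.
split=> [s t s0 st tL||] /=.
- rewrite geo_speed -/L !cE ?s0 ?(le_trans st)// ?(le_trans s0)//.
  by rewrite -mulrBl normrM [X in _ * X * _]ger0_norm ?invr_ge0// divfK// distrC ger0_norm ?subr_ge0.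
- by apply: hE; rewrite cE ?lexx// mul0r.
- by apply: hE; rewrite cE ?lexx ?L0// divff.
Qed.

End IsometricCurves.

(** * The arm of points reached by minimal curves with a given start *)

Section Arms.
Context {R : realType} {X : pmetricType R} (m : {measure set (borel X) -> \bar R}).
Hypothesis m_locally_finite : locally_finite m.
Hypothesis m_support : Defs.support m = [set: X].
Hypothesis maps : forall mu0 mu1 : probability (borel X) R, P2ac m mu0 -> P2 mu1 ->
  exists2 pi, OptGeo mu0 mu1 pi & induced_by_map mu0 pi.

Variables (x : X) (k : R -> X) (l : R).
Hypothesis l_gt0 : 0 < l.
Hypothesis k_isometric : isometric_on l k.
Hypothesis k0 : k 0 = x.
Hypothesis k_open : forall e, 0 < e <= l ->
  exists A : set X, [/\ open A, A !=set0 & forall y, A y -> exists2 s, 0 < s < e & y = k s].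

Local Notation rho := (mdist x).

(** Agreement with [k] is asked only on the common range of parameters, so that points of [k] at
    distance less than [l] belong to the arm too. *)
Definition extends (z : X) (g : R -> X) : Prop :=
  [/\ isometric_on (rho z) g, g (rho z) = z &
      forall s, 0 <= s <= l -> s <= rho z -> g s = k s].

Definition arm : set X := [set z | exists g, extends z g].

Lemma extends_rho z g s : extends z g -> 0 <= s <= rho z -> rho (g s) = s.
Proof.
move=> [giso _ gk] /andP[s0 sz].
have g0 : g 0 = x by rewrite gk ?lexx ?(ltW l_gt0) ?mdist_ge0.
by rewrite -{1}g0 giso// subr0.
Qed.

Lemma extends_point z g s : extends z g -> 0 <= s <= rho z -> extends (g s) g.
Proof.
move=> zg s0z; rewrite /extends (extends_rho zg s0z).
case: zg s0z => giso _ gk /andP[s0 sz]; split=> // [|u ul us].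
  exact: isometric_onW giso.
by apply: gk => //; exact: le_trans sz.
Qed.

Lemma extends_start s : 0 <= s <= l -> rho (k s) = s /\ extends (k s) k.
Proof.
move=> /andP[s0 sl]; have rs : rho (k s) = s by rewrite -{1}k0 k_isometric// subr0.
by split=> //; split; rewrite ?rs//; exact: isometric_onW k_isometric.
Qed.

(** Otherwise the curves to [z1] and [z2] share their start along [k], which contains an open set,
    and then branch. *)
Lemma arm_rho_inj z1 z2 : arm z1 -> arm z2 -> rho z1 = rho z2 -> z1 = z2.
Proof.
move=> [g1 z1g1] [g2 z2g2] tE; apply: contrapT => z12.
set t := rho z1 in tE.
have d0 : 0 < mdist z1 z2 by rewrite mdist_gt0; apply/eqP.
have t0 : 0 < t.
  rewrite lt_neqAle mdist_ge0 andbT; apply/eqP => t0; apply: z12.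
  by transitivity x; [apply/esym|]; apply: mdist_positivity; rewrite // -tE.
(* Starting points lie on [k] within [e] of [x] and flow for [c = t - e], ending within [e] of [z1]
   or of [z2]. Since [3 e <= mdist z1 z2], the closed ball of radius [e] about [z1] separates the
   two kinds of images. *)
pose e := Num.min l (Num.min t (mdist z1 z2 / 3)).
have e0 : 0 < e by rewrite !lt_min l_gt0 t0 divr_gt0.
have el : e <= l by rewrite ge_min lexx.
have et : e <= t by rewrite !ge_min lexx orbT.
have ed : e <= mdist z1 z2 / 3 by rewrite !ge_min lexx !orbT.
have /k_open[A [oA [a0 Aa0] AP]] : 0 < e <= l by rewrite e0.
pose c := t - e.
have [giso1 gz1 gk1] := z1g1; have [giso2 gz2 gk2] := z2g2.
rewrite -/t in giso1 gz1 gk1; rewrite -tE in giso2 gz2 gk2.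
have rhoA a : A a -> exists2 s, 0 < s < e & [/\ a = k s, rho a = s, g1 s = a & g2 s = a].
  move=> /AP[s /andP[s0 se] ->]; exists s; first by rewrite s0.
  have sl : 0 <= s <= l by rewrite ltW//= (le_trans (ltW se)).
  have st : s <= t by rewrite (le_trans (ltW se)).
  by split; [|exact: (extends_start sl).1|exact: gk1|exact: gk2].
have cont (g : R -> X) b : isometric_on t g -> continuous (fun y => g (clamp 0 t (rho y + b))).
  move=> giso y; apply: (@continuous_comp _ _ _ (fun y => rho y + b) (fun s => g (clamp 0 t s))).
    by apply: continuousD; [exact: mdist_continuous|exact: cst_continuous].
  exact: isometric_on_clamp_continuous (ltW t0) giso _.
(* Flowing back along [g1] undoes both flows, because [g1] and [g2] agree before time [e]. *)
apply: (@no_branching _ _ _ m_locally_finite m_support maps A [set y | mdist z1 y <= e] a0 rho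
  (fun y => g1 (clamp 0 t (rho y + c))) (fun y => g2 (clamp 0 t (rho y + c)))
  (fun y => g1 (clamp 0 t (rho y - c))) c) => //.
- have /continuous_closedP := @mdist_continuous R X z1.
  by move=> /(_ [set y | y <= e]); apply; exact: closed_le.
- by move=> y z; exact: mdist_reverse_triangle.
- exact: cont.
- exact: cont.
- exact: cont.
- move=> a b /rhoA[s _ [aE ra _ _]] /rhoA[s' _ [bE rb _ _]].
  by rewrite ra rb aE bE => ->.
- move=> a /rhoA[s /andP[s0 se] [_ rs g1s _]]; rewrite rs.
  rewrite (clamp_id (t := s + c)); last by rewrite /c; apply/andP; split; lra.
  rewrite (extends_rho z1g1); last by rewrite -/t /c; apply/andP; split; lra.
  rewrite addrK clamp_id; last by apply/andP; split; lra.
  split=> //.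
    by rewrite -{1}g1s giso1//; rewrite /c; lra.
  rewrite /= -{1}gz1 metric_sym giso1//; rewrite /c; lra.
- move=> a /rhoA[s /andP[s0 se] [_ rs g1s g2s]]; rewrite rs.
  rewrite (clamp_id (t := s + c)); last by rewrite /c; apply/andP; split; lra.
  rewrite (extends_rho z2g2); last by rewrite -tE /c; apply/andP; split; lra.
  rewrite addrK clamp_id; last by apply/andP; split; lra.
  split=> //.
    by rewrite -{1}g2s giso2//; rewrite /c; lra.
  have : mdist (g2 (s + c)) z2 = e - s.
    by rewrite -{1}gz2 giso2//; rewrite /c; lra.
  by have := metric_triangle z1 (g2 (s + c)) z2; rewrite /=; lra.
Qed.

(** Both [w] and [g (rho w)] are points of the arm at the same distance from [x]. Hence one curve
    passes through all closer points of the arm. *)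
Lemma extends_arm z g w : extends z g -> arm w -> rho w <= rho z -> g (rho w) = w.
Proof.
move=> zg aw wz; have wz' : 0 <= rho w <= rho z by rewrite mdist_ge0.
apply: arm_rho_inj => //; last exact: extends_rho zg wz'.
by exists g; exact: extends_point zg wz'.
Qed.

Lemma arm_isometric z w : arm z -> arm w -> mdist z w = `|rho z - rho w|.
Proof.
have le_case u v : arm u -> arm v -> rho u <= rho v -> mdist u v = rho v - rho u.
  move=> au [g vg] uv; rewrite -{1}(extends_arm vg au uv).
  by have [giso gv _] := vg; rewrite -{1}gv giso// mdist_ge0.
move=> az aw; have [zw|/ltW wz] := lerP (rho z) (rho w); first exact: le_case.
by rewrite metric_sym; exact: le_case.
Qed.

Lemma arm_downward z s : arm z -> 0 <= s <= rho z -> exists2 w, arm w & rho w = s.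
Proof.
move=> [g zg] sz; exists (g s); last exact: extends_rho zg sz.
by exists g; exact: extends_point zg sz.
Qed.

(** If the arm reaches as far as a limit point [z], then [z] is its point at distance [rho z]. If it
    does not, its points at all smaller distances form a curve that [z] completes. *)
Lemma arm_closed : closed arm.
Proof.
move=> z clz.
have near_z e : 0 < e -> exists2 w, arm w & mdist z w < e.
  move=> e0; have [|w [aw]] := clz (ball z e); first exact: nbhsx_ballx.
  by rewrite ballEmdist; exists w.
have rho_near w : `|rho z - rho w| <= mdist z w by exact: mdist_reverse_triangle.
have [[y ay zy]|nofar] := pselect (exists2 y, arm y & rho z <= rho y).
  have [w aw wz] := arm_downward ay (introT andP (conj (mdist_ge0 x z) zy)).
  suff -> : z = w by [].
  apply/eqP; rewrite -[_ == _]negbK -mdist_gt0; apply/negP => zw.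
  have [|v av zv] := near_z (mdist z w / 2); first by rewrite divr_gt0.
  have := metric_triangle z v w; rewrite (arm_isometric av aw) wz distrC.
  by have := rho_near v; lra.
have far w : arm w -> rho w < rho z.
  by move=> aw; rewrite ltNge; apply/negP => zw; apply: nofar; exists w.
(* The choice is [z] from [rho z] on, and also for negative [u], where the value is irrelevant. *)
have fill u : exists y, (0 <= u < rho z -> arm y /\ rho y = u) /\ (rho z <= u -> y = z).
  have [zu|uz] := lerP (rho z) u.
    by exists z; split=> // /andP[].
  have [u0|u0] := ltrP u 0.
    by exists z; split=> // /andP[].
  have [|w aw zw] := near_z (rho z - u); first by rewrite subr_gt0.
  have [|y ay yu] := arm_downward (s := u) aw.
    by rewrite u0; have := rho_near w; have := far _ aw; case: ler0P; lra.
  by exists y.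
have [g gP] := choice fill.
have gz : g (rho z) = z by apply: (gP _).2.
exists g; split=> //.
  move=> s t s0 st tz; have [tz'|tz'] := eqVneq t (rho z).
    have [sz'|sz'] := eqVneq s (rho z).
      by rewrite tz' sz' mdistxx subrr.
    have sz : s < rho z by rewrite lt_neqAle sz' (le_trans st).
    have [asz gs] := (gP s).1 (introT andP (conj s0 sz)).
    (* Replacing [z] by a point [w] of the arm within half of the defect changes [mdist (g s) z] and
       [rho z] by less than that each, and for [w] there is no defect. *)
    rewrite tz' gz; apply/eqP; rewrite -subr_eq0 -normr_le0 leNgt; apply/negP.
    move=> d0; have [|w aw zw] := near_z (`|mdist (g s) z - (rho z - s)| / 2).
      by rewrite divr_gt0.
    have := mdist_reverse_triangle (g s) z w; have := rho_near w; move: zw.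
    rewrite (arm_isometric asz aw) gs !ler_norml => zw /andP[h1 h2] /andP[h4 h5].
    suff : `|mdist (g s) z - (rho z - s)| <= mdist z w + mdist z w by lra.
    rewrite ler_norml; move: h4 h5; case: (lerP s (rho w)) => h3 h4 h5; apply/andP; split; lra.
  have {}tz : t < rho z by rewrite lt_neqAle tz'.
  have [at_ gt_] := (gP t).1 (introT andP (conj (le_trans s0 st) tz)).
  have [as_ gs_] := (gP s).1 (introT andP (conj s0 (le_lt_trans st tz))).
  by rewrite (arm_isometric as_ at_) gs_ gt_ distrC ger0_norm ?subr_ge0.
move=> s /[dup] sl /andP[s0 _] sz; have [rs ks] := extends_start sl.
have ak : arm (k s) by exists k.
have {}sz : s < rho z by rewrite -rs; exact: far.
have [as_ gs_] := (gP s).1 (introT andP (conj s0 sz)).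
by apply: arm_rho_inj => //; rewrite rs.
Qed.

End Arms.

(** * The chart of the given ball *)

Section BallChart.
Context {R : realType} {X : metricType R}.

(** An isometric parametrisation of the ball by (-r, r), centred at [x]; the values of [g] elsewhere
    are arbitrary. *)
Definition ball_chart (x : X) (r : R) (g : R -> X) : Prop :=
  [/\ 0 < r, g 0 = x,
      forall s t, `|s| < r -> `|t| < r -> mdist (g s) (g t) = `|s - t| &
      forall y, mdist x y < r -> exists2 s, `|s| < r & g s = y].

(** Reversing the orientation makes every result on the right arm available on the left. *)
Lemma ball_chart_opp x r g : ball_chart x r g -> ball_chart x r (g \o -%R).
Proof.
move=> [r0 g0 giso gsurj]; split=> //=.
- by rewrite oppr0.
- by move=> s t sr tr; rewrite giso ?normrN// -opprD normrN.
- by move=> y /gsurj[s sr gs]; exists (- s); rewrite /= ?normrN ?opprK.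
Qed.

Lemma ball_chart_isometric x r g l : ball_chart x r g -> l < r -> isometric_on l g.
Proof.
move=> [r0 _ giso _] lr s t s0 st tl.
rewrite giso; first by rewrite distrC ger0_norm// subr_ge0.
- by rewrite ger0_norm//; lra.
- by rewrite ger0_norm//; lra.
Qed.

Lemma ball_chart_open x r g e : ball_chart x r g -> 0 < e <= r ->
  exists A : set X, [/\ open A, A !=set0 & forall y, A y -> exists2 s, 0 < s < e & y = g s].
Proof.
move=> [r0 g0 giso gsurj] /andP[e0 er].
have er2 : `|e / 2| < r by rewrite ger0_norm; lra.
exists (ball (g (e / 2)) (e / 2)); split; first exact: mdist_ball_open.
  by exists (g (e / 2)); apply: ballxx; lra.
move=> y; rewrite ballEmdist /= => ye.
have xe : mdist x (g (e / 2)) = e / 2.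
  by rewrite -g0 giso ?normr0// sub0r normrN ger0_norm//; lra.
have [|s sr gs] := gsurj y; first by have := metric_triangle x (g (e / 2)) y; lra.
exists s => //; move: ye; rewrite -gs giso// ltr_norml => /andP[h1 h2].
by apply/andP; split; lra.
Qed.

(** [f x] may lie anywhere in [I], so the radius shrinks until the interval of radius [r'] about
    [f x] fits in [I]; there [g] inverts [f] after a translation. *)
Lemma ball_chart_of_isometry (x : X) (r : R) (I : set R) : 0 < r -> open I ->
  isometric_sets (ball x r) (I : set R^o) -> exists r' g, ball_chart x r' g.
Proof.
move=> r0 oI [f [fI finj fsurj] fiso].
have Bx : ball x r x by exact: ballxx.
have /nbhs_ballP[e /= e0 eI] : nbhs (f x) I.
  by apply: open_nbhs_nbhs; split=> //; exact: fI.
pose r' := Num.min e r; have r'0 : 0 < r' by rewrite lt_min e0.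
have [re rr] : r' <= e /\ r' <= r by rewrite !ge_min !lexx orbT.
have ex s : exists y, `|s| < r' -> ball x r y /\ f y = f x + s.
  have [sr|sr] := ltrP `|s| r'; last by exists x.
  have [|y By fy] := fsurj (f x + s).
    by apply: eI; rewrite /ball/= opprD addrA subrr add0r normrN (lt_le_trans sr).
  by exists y.
have [g gP] := choice ex.
have fd y z : ball x r y -> ball x r z -> mdist y z = `|f z - f y|.
  by move=> By Bz; rewrite -fiso.
exists r', g; split=> //.
- have [|Bg fg] := gP 0; first by rewrite normr0.
  by apply: mdist_positivity; rewrite fd// fg addr0 subrr normr0.
- move=> s t /gP[Bs fs] /gP[Bt ft]; rewrite fd// fs ft distrC.
  by congr Num.norm; rewrite opprD addrACA subrr add0r.
- move=> y yr; have By : ball x r y by rewrite ballEmdist; exact: lt_le_trans rr.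
  have yr' : `|f y - f x| < r' by rewrite -fd.
  exists (f y - f x) => //; have [Bg fg] := gP _ yr'.
  by apply: mdist_positivity; rewrite fd// fg [f x + _]addrC subrK subrr normr0.
Qed.

(** A minimal curve that moves to the right near [x] crosses [g (r / 4)]: [a (r / 4 - s)] is some
    [g t], and its distances to [g s] and [g (s + r / 4)] leave only [t = r / 4]. *)
Lemma isometric_through (x : X) r g s L a : ball_chart x r g ->
  isometric_on L a -> `|s| < r / 4 -> r / 2 <= L -> a 0 = g s ->
  a (r / 4) = g (s + r / 4) -> a (r / 4 - s) = g (r / 4).
Proof.
move=> [r0 g0 giso gsurj] aiso; rewrite ltr_norml => /andP[s1 s2] rL a0 a1.
have xs : mdist x (g s) < r / 4.
  by rewrite -g0 giso ?normr0// ?sub0r ?normrN ltr_norml; apply/andP; split; lra.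
have d0 : mdist (g s) (a (r / 4 - s)) = r / 4 - s.
  by rewrite -a0 aiso ?subr0//; lra.
have [|t tr gt_] := gsurj (a (r / 4 - s)).
  by have := metric_triangle x (g s) (a (r / 4 - s)); lra.
have sr : `|s| < r by rewrite ltr_norml; apply/andP; split; lra.
have d1 : `|s - t| = r / 4 - s by rewrite -giso// gt_.
have d2 : `|s + r / 4 - t| = `|s|.
  rewrite -giso//; last by rewrite ltr_norml; apply/andP; split; lra.
  rewrite gt_ -a1 (isometric_on_dist aiso).
  - by congr Num.norm; lra.
  - by apply/andP; split; lra.
  - by apply/andP; split; lra.
rewrite -gt_; congr g; move: d1 d2.
by case: (ler0P s) => h1; case: (ler0P (s - t)) => h2;
  case: (ler0P (s + r / 4 - t)) => h3; lra.
Qed.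

End BallChart.

(** * The two arms cover the space *)

Section Cover.
Context {R : realType} {X : pmetricType R}.

Lemma arm_of_geodesic (x z : X) r g s L a : ball_chart x r g ->
  isometric_on L a -> `|s| < r / 4 -> r / 2 <= L -> a 0 = g s -> a L = z ->
  a (r / 4) = g (s + r / 4) ->
  r / 4 + mdist (g (r / 4)) z = L + s /\ (mdist x z = L + s -> arm x g (r / 4) z).
Proof.
move=> gB aiso s_lt rL a0 aL a1; have az := isometric_through gB aiso s_lt rL a0 a1.
have [r0 g0 giso gsurj] := gB; have giso' : isometric_on (r / 4) g.
  by apply: ball_chart_isometric gB _; lra.
move: (s_lt); rewrite ltr_norml => /andP[s1 s2].
have dz : mdist (g (r / 4)) z = L - (r / 4 - s) by rewrite -az -aL aiso//; lra.
split; first by rewrite dz; lra.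
(* Follow the chart from [x] to [g (r / 4)], then the curve [a], which is there at its time
   [r / 4 - s]. *)
move=> xz; exists (fun u => if u <= r / 4 then g u else a (u - s)); rewrite /extends xz.
have azs : a (L + s - s) = z by rewrite addrK.
split.
- move=> u v u0 uv vL; case: ifPn => [ul|]; last rewrite -ltNge => lu.
    case: ifPn => [vl|]; first by rewrite giso'.
    rewrite -ltNge => lv; apply/eqP; rewrite eq_le; apply/andP; split.
      have := metric_triangle (g u) (g (r / 4)) (a (v - s)).
      rewrite (giso' u (r / 4)); [|lra..].
      by rewrite -az aiso; lra.
    (* A shortcut from [g u] to [a (v - s)] would join [x] to [z] in less than [mdist x z]. *)
    have := metric_triangle x (g u) z; have := metric_triangle (g u) (a (v - s)) z.
    rewrite xz -{1}g0 (giso' 0 u); [|lra..].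
    by rewrite -{2}aL aiso; lra.
  rewrite ifF; last by apply/negbTE; rewrite -ltNge; lra.
  by rewrite aiso; lra.
- by case: ifPn => // h; exfalso; lra.
- by move=> u /andP[_ ->].
Qed.

Context (m : {measure set (borel X) -> \bar R}).
Hypothesis m_locally_finite : locally_finite m.
Hypothesis m_support : Defs.support m = [set: X].
Hypothesis maps : forall mu0 mu1 : probability (borel X) R, P2ac m mu0 -> P2 mu1 ->
  exists2 pi, OptGeo mu0 mu1 pi & induced_by_map mu0 pi.

Lemma minimal_curve_from_open_set (A : set X) (a z : X) : open A -> A a ->
  exists y g, [/\ A y, isometric_on (mdist y z) g, g 0 = y & g (mdist y z) = z].
Proof.
move=> oA Aa.
have [h [Ah hz]] := geodesic_from_open_set m_locally_finite m_support maps z oA Aa.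
have [g [giso g0 g1]] := geo_isometric h; rewrite hz in giso g1.
by exists (h 0%:i01), g; split.
Qed.

(** Minimal curves to [z] are at hand only from points near [x]. For [z] outside the ball, one that
    starts close enough to [x] shows that [g (r / 4)] or [g (- (r / 4))] lies on a minimal route
    from [x] to [z]. *)
Lemma arms_cover (x z : X) r g : ball_chart x r g ->
  arm x g (r / 4) z \/ arm x (g \o -%R) (r / 4) z.
Proof.
move=> gB; have [r0 g0 giso gsurj] := gB; have gB' := ball_chart_opp gB.
have [/gsurj[s sr <-]|xz] := ltrP (mdist x z) r.
  have near_arm h : ball_chart x r h -> forall t, 0 <= t < r -> arm x h (r / 4) (h t).
    move=> hB t /andP[t0 tr]; exists h.
    have [_ h0 _ _] := hB; have hiso := ball_chart_isometric hB tr.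
    have xt : mdist x (h t) = t by rewrite -h0 hiso// subr0.
    by split; rewrite ?xt.
  have [s0|s0] := lerP 0 s.
    by left; apply: near_arm => //; rewrite s0 -(ger0_norm s0).
  right; rewrite -[s]opprK; apply: (near_arm _ gB').
  by rewrite -(ltr0_norm s0) normr_ge0.
(* [gap h] is the excess of the route through [h (r / 4)]. A curve starting at distance [|s|] from
   [x] and leaving along [h] forces [gap h <= 2 |s|], so staying below half of a positive gap forces
   the gap to vanish. *)
pose gap h := r / 4 + mdist (h (r / 4)) z - mdist x z.
pose dl h := if 0 < gap h then gap h / 2 else r / 4.
have dl0 h : 0 < dl h by rewrite /dl; case: ifPn => h0; lra.
pose d := Num.min (r / 4) (Num.min (dl g) (dl (g \o -%R))).
have d0 : 0 < d by rewrite !lt_min !dl0; lra.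
have [dr dg dg'] : [/\ d <= r / 4, d <= dl g & d <= dl (g \o -%R)].
  by rewrite /d !ge_min !lexx !orbT.
have [y [a [+ aiso a0 aL]]] := minimal_curve_from_open_set z
  (mdist_ball_open x d) (ballxx x d0).
rewrite ballEmdist /= => xy; set L := mdist y z in aiso aL.
have [|s sr gs] := gsurj y; first by lra.
have xs : `|s| = mdist x y.
  by rewrite -gs -g0 giso ?normr0// sub0r normrN.
have Ls : `|L - mdist x z| <= `|s|.
  have := mdist_reverse_triangle z x y.
  by rewrite distrC !(metric_sym z) xs.
have sd : `|s| < d by rewrite xs.
have [|t tr gt_] := gsurj (a (r / 4)).
  have := metric_triangle x y (a (r / 4)).
  by rewrite -{2}a0 aiso; move: Ls; rewrite ?ler_norml; lra.
have st : `|s - t| = r / 4.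
  rewrite -giso// gt_ gs -a0 aiso; first by rewrite subr0.
  - by [].
  - by lra.
  - by move: Ls; rewrite ler_norml; lra.
have conclude k s' : ball_chart x r k -> d <= dl k -> `|s'| = `|s| -> a 0 = k s' ->
    a (r / 4) = k (s' + r / 4) -> arm x k (r / 4) z.
  move=> kB dk s's a0' a1'.
  have [||kz] := arm_of_geodesic kB aiso _ _ a0' aL a1'; [lra| |].
    by move: Ls; rewrite ler_norml; lra.
  apply; move: dk; rewrite /dl /gap kz; case: ifPn.
    have := ler_norm s'; move: Ls; rewrite ler_norml => /andP[]; lra.
  rewrite -leNgt => h1 _.
  have := metric_triangle x (k (r / 4)) z; have [_ k0 kiso _] := kB.
  rewrite -{2}k0 (ball_chart_isometric kB (l := r / 4)); lra.
(* The curve leaves [y] to the right or to the left. *)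
have [ts|ts] : t = s + r / 4 \/ t = s - r / 4.
  by move: st; case: (ler0P (s - t)); [left|right]; lra.
- by left; apply: (conclude g s) => //; rewrite ?a0// -ts.
- right; apply: (conclude _ (- s)) => //=; rewrite ?normrN// ?opprK ?a0//.
  by rewrite opprD opprK -ts.
Qed.

End Cover.

(** * Manifold charts from real coordinates *)

Section IntervalChart.
Context {R : realType} {X : metricType R}.

Definition chart_around (p : X) : Prop := exists (U : set X) (V : set R),
  [/\ open U, U p, open V & homeomorphic_sets U (V `&` `[0, +oo[)].

(** [f] does not shrink distances, so its inverse is nonexpansive. The sign [sg] and the origin [a]
    place its image in the half line. *)
Lemma affine_chart (U : set X) (f : X -> R) (p : X) (W V : set R) (a sg : R) :
  open U -> U p -> (forall y, U y -> {for y, continuous f}) ->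
  (forall y z, U y -> U z -> mdist y z <= `|f y - f z|) ->
  open W -> W (f p) -> open V -> sg * sg = 1 ->
  (forall y, U y -> W (f y) -> V (sg * (f y - a)) /\ 0 <= sg * (f y - a)) ->
  (forall u, V u -> 0 <= u -> exists2 y, U y & f y = a + sg * u /\ W (f y)) ->
  chart_around p.
Proof.
move=> oU Up cf f_exp oW Wp oV sg2 UWV VUW.
have [g gP] : {g : R -> X & forall u, V u -> 0 <= u ->
    [/\ U (g u), f (g u) = a + sg * u & W (f (g u))]}.
  apply: (@choice _ _ (fun u y => V u -> 0 <= u -> [/\ U y, f y = a + sg * u & W (f y)])).
  move=> u; have [[Vu u0]|nVu] := pselect (V u /\ 0 <= u).
    by have [y Uy [fy Wy]] := VUW u Vu u0; exists y.
  by exists p => Vu u0; exfalso; exact: nVu.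
exists (U `&` f @^-1` W), V; split=> //.
  rewrite openE => y [Uy Wy]; apply: filterI; first exact: open_nbhs_nbhs.
  by apply: (cf y Uy); exact: open_nbhs_nbhs.
exists (fun y => sg * (f y - a)), g; split.
- apply: continuous_in_subspaceT => y /set_mem[Uy _].
  apply: cvgM; first exact: cvg_cst.
  by apply: cvgB; [exact: cf|exact: cvg_cst].
- apply/subspace_continuousP => u [Vu]; rewrite /= in_itv/= andbT => u0.
  apply/metricType_numDomainType.cvgrPdist_lt => e e0; near=> t.
  have [Vt] : (V `&` `[0, +oo[) t by near: t; exact: withinT.
  rewrite /= in_itv/= andbT => t0.
  have [Ug fg _] := gP _ Vu u0; have [Ut ft _] := gP _ Vt t0.
  apply: le_lt_trans (f_exp _ _ Ug Ut) _; rewrite fg ft opprD addrACA subrr add0r.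
  rewrite -mulrBr normrM.
  have -> : `|sg| = 1 by apply/eqP; rewrite -sqrp_eq1// -normrX expr2 sg2 normr1.
  rewrite mul1r; near: t; apply: cvg_within; exact: (nbhsx_ballx u _ e0).
- move=> y [Uy Wy]; have [Vy y0] := UWV _ Uy Wy.
  rewrite /= in_itv/= y0; split=> //.
  have [Ug fg _] := gP _ Vy y0; apply: mdist_positivity; apply/eqP.
  rewrite eq_le mdist_ge0 andbT; apply: le_trans (f_exp _ _ Ug Uy) _.
  by rewrite fg mulrA sg2 mul1r [a + _]addrC subrK subrr normr0.
- move=> u [Vu]; rewrite /= in_itv/= andbT => u0; have [Ug fg Wg] := gP _ Vu u0.
  by split=> //; rewrite fg [a + _]addrC addrK mulrA sg2 mul1r.
Unshelve. all: by end_near. Qed.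

(** [f] identifies [U] with an interval, not reduced to a point thanks to [q]. The chart depends on
    whether [f p] is an inner, largest or smallest value; the last two make [p] a boundary point. *)
Lemma interval_chart (U : set X) (f : X -> R) (p q : X) :
  open U -> U p -> U q -> q <> p ->
  (forall y, U y -> {for y, continuous f}) ->
  (forall y z, U y -> U z -> mdist y z <= `|f y - f z|) ->
  is_interval (f @` U) -> chart_around p.
Proof.
move=> oU Up Uq qp cf f_exp itvU.
have fqp : f q != f p.
  apply/eqP => fqp; apply: qp; apply: mdist_positivity; apply/eqP.
  by rewrite eq_le mdist_ge0 andbT; have := f_exp _ _ Uq Up; rewrite fqp subrr normr0.
have fill y z t : U y -> U z -> f y <= t <= f z -> exists2 w, U w & f w = t.
  move=> Uy Uz tyz; have [w Uw fw] := itvU _ _ (ex_intro2 _ _ y Uy erefl)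
    (ex_intro2 _ _ z Uz erefl) t tyz.
  by exists w.
have [[y Uy yp]|nolt] := pselect (exists2 y, U y & f y < f p);
  have [[z Uz pz]|nogt] := pselect (exists2 z, U z & f p < f z).
- apply: (@affine_chart U f p `]f y, f z[ `]0, f z - f y[ (f y) 1) => //.
  + by rewrite /= in_itv/= yp.
  + by rewrite mul1r.
  + by move=> w Uw; rewrite /= !in_itv/= => /andP[h1 h2]; split; [apply/andP; split|]; lra.
  + move=> u; rewrite /= !in_itv/= => /andP[h1 h2] _; have [|w Uw fw] := fill y z (f y + u) Uy Uz.
      by apply/andP; split; lra.
    by exists w; rewrite // mul1r fw; split=> //; rewrite in_itv/=; apply/andP; split; lra.
- apply: (@affine_chart U f p `]f y, +oo[ `]-oo, f p - f y[ (f p) (-1)) => //.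
  + by rewrite /= in_itv/= yp.
  + by rewrite mulrNN mul1r.
  + move=> w Uw; rewrite /= !in_itv/= andbT => h1.
    have h2 : f w <= f p by rewrite leNgt; apply/negP => h; apply: nogt; exists w.
    by split; lra.
  + move=> u; rewrite /= !in_itv/= => h1 h2; have [|w Uw fw] := fill y p (f p - u) Uy Up.
      by apply/andP; split; lra.
    by exists w; rewrite // mulN1r fw; split=> //; rewrite in_itv/= andbT; lra.
- apply: (@affine_chart U f p `]-oo, f z[ `]-oo, f z - f p[ (f p) 1) => //.
  + by rewrite mul1r.
  + move=> w Uw; rewrite /= !in_itv/= => h1.
    have h2 : f p <= f w by rewrite leNgt; apply/negP => h; apply: nolt; exists w.
    by split; lra.
  + move=> u; rewrite /= !in_itv/= => h1 h2; have [|w Uw fw] := fill p z (f p + u) Up Uz.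
      by apply/andP; split; lra.
    by exists w; rewrite // mul1r fw; split=> //; rewrite in_itv/=; lra.
- exfalso; move: fqp; rewrite neq_lt => /orP[h|h]; [apply: nolt|apply: nogt]; by exists q.
Qed.

(** The pasting lemma at a single point: agreement is asked only near [y], so that a coordinate may
    jump elsewhere. *)
Lemma closed_pasting (P N : set X) (f a b : X -> R) (y : X) :
  closed P -> closed N -> (forall z, P z \/ N z) ->
  {for y, continuous a} -> {for y, continuous b} ->
  (\forall z \near y, P z -> f z = a z) -> (\forall z \near y, N z -> f z = b z) ->
  {for y, continuous f}.
Proof.
move=> cP cN PN ca cb fa fb W Wy.
have half (Q : set X) (h : X -> R) : closed Q -> {for y, continuous h} ->
    (\forall z \near y, Q z -> f z = h z) -> \forall z \near y, Q z -> W (f z).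
  move=> cQ ch fh; have [Qy|nQy] := pselect (Q y).
    have Why : nbhs (h y) W by rewrite -(nbhs_singleton fh Qy).
    by near=> z => Qz; rewrite (near fh z)//; near: z; exact: ch.
  have oQ : open (~` Q) by rewrite openC.
  have := open_nbhs_nbhs (conj oQ nQy); apply: filterS => z nQz Qz.
  by exfalso; exact: nQz.
suff : nbhs y (f @^-1` W) by [].
have hP := half _ _ cP ca fa; have hN := half _ _ cN cb fb.
near=> z; have [Pz|Nz] := PN z; first by apply: (near hP z).
by apply: (near hN z).
Unshelve. all: by end_near. Qed.

End IntervalChart.

(** * Arms that meet away from their origin *)

Section TwoArms.
Context {R : realType} {X : pmetricType R} (m : {measure set (borel X) -> \bar R}).
Hypothesis m_locally_finite : locally_finite m.
Hypothesis m_support : Defs.support m = [set: X].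
Hypothesis maps : forall mu0 mu1 : probability (borel X) R, P2ac m mu0 -> P2 mu1 ->
  exists2 pi, OptGeo mu0 mu1 pi & induced_by_map mu0 pi.

Lemma chart_arm (x : X) r h : ball_chart x r h -> let P := arm x h (r / 4) in
  [/\ P x, closed P,
      forall y z, P y -> P z -> mdist y z = `|mdist x y - mdist x z|,
      forall y z, P y -> P z -> mdist x y = mdist x z -> y = z &
      forall y s, P y -> 0 <= s <= mdist x y -> exists2 w, P w & mdist x w = s].
Proof.
move=> hB; have [r0 h0 _ _] := hB.
have l0 : 0 < r / 4 by lra.
have hiso : isometric_on (r / 4) h by apply: ball_chart_isometric hB _; lra.
have hopen e : 0 < e <= r / 4 -> exists A : set X,
    [/\ open A, A !=set0 & forall y, A y -> exists2 s, 0 < s < e & y = h s].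
  by move=> /andP[e0 el]; apply: (ball_chart_open hB); rewrite e0; lra.
split.
- have [|_ hx] := extends_start hiso h0 (s := 0); first by rewrite lexx ltW.
  by exists h; rewrite -h0 /extends; rewrite h0 in hx *.
- exact: (arm_closed m_locally_finite m_support maps l0 hiso h0 hopen).
- exact: (arm_isometric m_locally_finite m_support maps l0 hiso h0 hopen).
- exact: (arm_rho_inj m_locally_finite m_support maps l0 hiso h0 hopen).
- by move=> y s; exact: (arm_downward l0 h0).
Qed.

(** Follow the other arm to [p], then the first one to [z]. The distance from [x] grows at unit
    speed all along, so the concatenation is minimal. *)
Lemma arm_reroute (x p z : X) r h k : ball_chart x r h ->
  arm x h (r / 4) p -> arm x k (r / 4) p -> arm x h (r / 4) z ->
  ball_chart x r k -> r / 4 <= mdist x p <= mdist x z -> arm x k (r / 4) z.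
Proof.
move=> hB hp [b pb] [a za] kB /andP[lp pz].
have [r0 h0 _ _] := hB; have l0 : 0 < r / 4 by lra.
have [_ k0 _ _] := kB.
have [hx _ h_iso h_inj h_down] := chart_arm hB.
have [biso bp bk] := pb; have [aiso az ak] := za.
have p0 : 0 <= mdist x p by exact: mdist_ge0.
have ra u : 0 <= u <= mdist x z -> mdist x (a u) = u by move=> uz; exact: (extends_rho l0 h0 za uz).
have rb u : 0 <= u <= mdist x p -> mdist x (b u) = u by move=> ut; exact: (extends_rho l0 k0 pb ut).
have ap : a (mdist x p) = p.
  apply: h_inj => //; last by apply: ra; rewrite p0.
  by exists a; apply: (extends_point l0 h0 za); rewrite p0.
exists (fun u => if u <= mdist x p then b u else a u); split.
- move=> u v u0 uv vz; case: ifPn => [up|].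
    case: ifPn => [vp|]; first exact: biso.
    rewrite -ltNge => pv; apply/eqP; rewrite eq_le; apply/andP; split.
      have d1 : mdist (b u) p = mdist x p - u by rewrite -{1}bp biso.
      have d2 : mdist p (a v) = v - mdist x p by rewrite -{1}ap aiso// ltW.
      by have := metric_triangle (b u) p (a v); lra.
    have := metric_triangle x (b u) (a v).
    by rewrite rb ?u0// ra; [lra|apply/andP; split; lra].
  rewrite -ltNge => pu; rewrite ifF; first exact: aiso.
  by apply/negbTE; rewrite -ltNge; lra.
- case: ifPn => // zp; have e : mdist x z = mdist x p by apply/eqP; rewrite eq_le zp.
  by rewrite e bp -ap -e.
- by move=> u ul uz; rewrite ifT; [apply: bk => //|]; move: ul => /andP[]; lra.
Qed.

(** If an arm went on beyond the first meeting point [p], rerouting would put an open shell beyond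
    [p] in both arms, and curves from the shell towards [x] would branch at [p]. *)
Lemma no_tail (x p y : X) r h k : ball_chart x r h -> ball_chart x r k ->
  (forall z, arm x h (r / 4) z \/ arm x k (r / 4) z) ->
  arm x h (r / 4) p -> arm x k (r / 4) p -> r / 4 <= mdist x p ->
  (forall z, arm x h (r / 4) z -> arm x k (r / 4) z -> z <> x ->
     mdist x p <= mdist x z) ->
  arm x h (r / 4) y -> mdist x y <= mdist x p.
Proof.
move=> hB kB hk hp kp lp p_min [a ya]; rewrite leNgt; apply/negP => py.
have [hx cP h_iso h_inj h_down] := chart_arm hB.
have [_ _ k_iso k_inj _] := chart_arm kB.
have [r0 h0 _ _] := hB; have [_ k0 _ _] := kB; have l0 : 0 < r / 4 by lra.
have [b pb] := kp; have [biso bp bk] := pb; have [aiso az ak] := ya.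
set t := mdist x p in lp p_min py biso bp bk *.
have ra u : 0 <= u <= mdist x y -> mdist x (a u) = u by move=> uz; exact: (extends_rho l0 h0 ya uz).
have rb u : 0 <= u <= t -> mdist x (b u) = u by move=> ut; exact: (extends_rho l0 k0 pb ut).
have ha u : 0 <= u <= mdist x y -> arm x h (r / 4) (a u).
  by move=> uy; exists a; exact: (extends_point l0 h0 ya uy).
have kb u : 0 <= u <= t -> arm x k (r / 4) (b u).
  by move=> ut; exists b; exact: (extends_point l0 k0 pb ut).
(* In the shell between [t] and [t + e], moving inwards by [e] crosses distance [t] without reaching
   [x], and the shell is within the range of [a]. *)
pose e := Num.min t (mdist x y - t).
have e0 : 0 < e by rewrite lt_min; apply/andP; split; lra.
have [et ey] : e <= t /\ e <= mdist x y - t by rewrite !ge_min !lexx orbT.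
pose A := [set z | t < mdist x z] `&` [set z | mdist x z < t + e].
have bothA z : A z -> arm x h (r / 4) z /\ arm x k (r / 4) z.
  move=> [/= tz _]; have tz' : r / 4 <= t <= mdist x z by rewrite lp ltW.
  have [hz|kz] := hk z.
    by split=> //; exact: arm_reroute hB hp kp hz kB tz'.
  by split=> //; exact: arm_reroute kB kp hp kz hB tz'.
have cont (g : R -> X) L (s : R) : 0 <= L -> isometric_on L g ->
    continuous (fun z => g (clamp 0 L (mdist x z + s))).
  move=> L0 giso z; apply: (@continuous_comp _ _ _ (fun z => mdist x z + s) (fun u => g (clamp 0 L u))).
    by apply: continuousD; [exact: mdist_continuous|exact: cst_continuous].
  exact: isometric_on_clamp_continuous L0 giso _.
(* The flow goes towards [x], so the potential is [- mdist x]. Along [a] it stays in the closed arm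
   of [h]; along [b] it leaves that arm, by minimality of [p]. Going outwards along [a] undoes
   both. *)
apply: (@no_branching _ _ _ m_locally_finite m_support maps A (arm x h (r / 4))
  (a (t + e / 2)) (fun z => - mdist x z)
  (fun z => a (clamp 0 (mdist x y) (mdist x z - e)))
  (fun z => b (clamp 0 t (mdist x z - e)))
  (fun z => a (clamp 0 (mdist x y) (mdist x z + e))) e) => //.
- apply: openI; have /continuousP cx := @mdist_continuous R X x.
    by apply: (cx [set u | t < u]); exact: open_gt.
  by apply: (cx [set u | u < t + e]); exact: open_lt.
- by split; rewrite /= ra; [lra|apply/andP; split; lra|lra|apply/andP; split; lra].
- by move=> z w; rewrite -opprD normrN; exact: mdist_reverse_triangle.
- by apply: cont => //; exact: mdist_ge0.
- by apply: cont => //; lra.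
- by apply: cont => //; exact: mdist_ge0.
- move=> z w /bothA[hz _] /bothA[hw _] /oppr_inj; exact: h_inj.
- move=> z Az; have [hz kz] := bothA z Az; have [/= tz zt] := Az.
  rewrite (clamp_id (t := mdist x z - e)); last by apply/andP; split; lra.
  have zey : 0 <= mdist x z - e <= mdist x y by apply/andP; split; lra.
  rewrite ra// subrK clamp_id; last by apply/andP; split; lra.
  split; last exact: ha.
  + by rewrite h_iso ?ra//; [rewrite opprB addrCA subrr addr0 ger0_norm; lra|exact: ha].
  + by rewrite opprB addrC.
  + have zy : 0 <= mdist x z <= mdist x y by apply/andP; split; lra.
    by apply: h_inj => //; [exact: ha|exact: ra].
- move=> z Az; have [hz kz] := bothA z Az; have [/= tz zt] := Az.
  rewrite (clamp_id (t := mdist x z - e)); last by apply/andP; split; lra.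
  have zet : 0 <= mdist x z - e <= t by apply/andP; split; lra.
  rewrite rb// subrK clamp_id; last by apply/andP; split; lra.
  split.
  + by rewrite k_iso ?rb//; [rewrite opprB addrCA subrr addr0 ger0_norm; lra|exact: kb].
  + by rewrite opprB addrC.
  + have zy : 0 <= mdist x z <= mdist x y by apply/andP; split; lra.
    by apply: h_inj => //; [exact: ha|exact: ra].
  + move=> hbz; have := p_min _ hbz (kb _ zet); rewrite rb// => H.
    suff : t <= mdist x z - e by lra.
    by apply: H => bx; have := rb _ zet; rewrite bx mdistxx; lra.
Qed.

End TwoArms.

Lemma separable_second_countable (R : realType) (X : metricType R) :
  separable X -> @second_countable X.
Proof.
move=> [D cD dD].
exists [set ball p.1 p.2.+1%:R^-1 | p in D `*` [set: nat]].
  by apply: card_le_trans (card_image_le _ _) _; exact: countableX.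
split; first by move=> _ [p _ <-]; exact: mdist_ball_open.
move=> x A /nbhs_ballP[e /= e0 eA].
have [n] := ltr_add_invr (divr_gt0 e0 (ltr0n R 2)); rewrite add0r => ne.
have n0 : 0 < n.+1%:R^-1 :> R by [].
have [||y [xy Dy]] := dD (ball x n.+1%:R^-1).
- by exists x; exact: ballxx.
- exact: mdist_ball_open.
exists (ball y n.+1%:R^-1).
  split; last exact: ball_sym.
  by exists (y, n).
move=> z /= yz; apply: eA; have := ball_triangle xy yz.
by apply: le_ball; rewrite [leRHS]splitr lerD ?ltW.
Qed.

(** * Charts at the centre, on an interval and on a punctured circle *)

Section LocalCharts.
Context {R : realType} {X : metricType R}.

Lemma ball_chart_center (x : X) r g : ball_chart x r g -> chart_around x.
Proof.
move=> gB; have [r0 g0 giso gsurj] := gB.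
have [f fP] : {f : X -> R & forall y, mdist x y < r -> `|f y| < r /\ g (f y) = y}.
  apply: (@choice _ _ (fun y s => mdist x y < r -> `|s| < r /\ g s = y)) => y.
  have [/gsurj[s sr gs]|] := ltrP (mdist x y) r; first by exists s.
  by exists 0.
have fiso y z : mdist x y < r -> mdist x z < r -> mdist y z = `|f y - f z|.
  by move=> /fP[fy gy] /fP[fz gz]; rewrite -giso// gy gz.
have r2 : `|r / 2| < r by rewrite ger0_norm; lra.
have gr s : `|s| < r -> mdist x (g s) < r.
  by move=> sr; rewrite -g0 giso ?normr0// sub0r normrN.
have fg s : `|s| < r -> f (g s) = s.
  move=> sr; have [h1 h2] := fP _ (gr _ sr).
  apply/eqP; rewrite -subr_eq0 -normr_eq0 -giso// h2 mdistxx eqxx.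
  by [].
have Bx : ball x r x by exact: ballxx.
apply: (@interval_chart _ _ (ball x r) f x (g (r / 2))) => //.
- exact: mdist_ball_open.
- by rewrite ballEmdist; exact: gr.
- move=> gx; have := giso (r / 2) 0 r2; rewrite normr0 gx g0 mdistxx subr0 => /(_ r0).
  by rewrite ger0_norm; lra.
- move=> y; rewrite ballEmdist => yr W /nbhs_ballP[e /= e0 eW]; apply/nbhs_ballP.
  exists (Num.min e (r - mdist x y)) => /=.
    by rewrite lt_min e0 subr_gt0.
  move=> z; rewrite ballEmdist /= lt_min => /andP[ze zr]; apply: eW.
  rewrite /ball/= -fiso//; have := metric_triangle x y z; lra.
- by move=> y z; rewrite ballEmdist => yr zr; rewrite fiso.
- move=> _ _ [y yr <-] [z zr <-] t /andP[ty tz].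
  rewrite ballEmdist in yr zr; have [fy _] := fP _ yr; have [fz _] := fP _ zr.
  have tr : `|t| < r by move: fy fz; rewrite !ltr_norml => /andP[? ?] /andP[? ?]; apply/andP; split; lra.
  by exists (g t); [rewrite ballEmdist; exact: gr|exact: fg].
Qed.

(** The signed distance from [x] is a global coordinate; across [x] it does not shrink distances, by
    the triangle inequality. *)
Lemma line_chart (x p : X) (P N : set X) :
  closed P -> closed N -> P x -> N x -> (forall z, P z \/ N z) ->
  (forall z, P z -> N z -> z = x) ->
  (forall y z, P y -> P z -> mdist y z = `|mdist x y - mdist x z|) ->
  (forall y z, N y -> N z -> mdist y z = `|mdist x y - mdist x z|) ->
  (forall y s, P y -> 0 <= s <= mdist x y -> exists2 w, P w & mdist x w = s) ->
  (forall y s, N y -> 0 <= s <= mdist x y -> exists2 w, N w & mdist x w = s) ->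
  p <> x -> chart_around p.
Proof.
move=> cP cN Px Nx PN PNx Piso Niso Pdown Ndown px.
pose f y : R := if `[< P y >] then mdist x y else - mdist x y.
have fP y : P y -> f y = mdist x y by move=> Py; rewrite /f asboolT.
have fN y : N y -> f y = - mdist x y.
  move=> Ny; rewrite /f; case: ifPn => // /asboolP Py.
  by rewrite (PNx y Py Ny) mdistxx oppr0.
have Nf y : f y < 0 -> N y.
  by case: (PN y) => // Py; rewrite fP// ltNge mdist_ge0.
have Pf y : 0 < f y -> P y.
  by case: (PN y) => // Ny; rewrite fN// oppr_gt0 ltNge mdist_ge0.
have dtri y z : mdist y z <= mdist x y + mdist x z.
  by have := metric_triangle y x z; rewrite (metric_sym y x).
apply: (@interval_chart _ _ setT f p x) => //.
- exact: openT.
- by move=> xp; exact: px.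
- move=> y _; apply: (@closed_pasting _ _ P N f (mdist x) (fun z => - mdist x z)) => //.
  + exact: mdist_continuous.
  + by apply: continuousN; exact: mdist_continuous.
  + by near=> z; exact: fP.
  + by near=> z; exact: fN.
- move=> y z _ _; have [Py|Ny] := PN y; have [Pz|Nz] := PN z.
  + by rewrite !fP// Piso.
  + rewrite fP// fN// opprK ger0_norm; first exact: dtri.
    by rewrite addr_ge0// mdist_ge0.
  + rewrite fN// fP// -opprD normrN ger0_norm; first exact: dtri.
    by rewrite addr_ge0// mdist_ge0.
  + by rewrite !fN// -opprD normrN Niso.
- move=> _ _ [y _ <-] [z _ <-] t /andP[yt tz].
  have [t0|t0|->] := ltrgtP t 0; last by exists x; rewrite // fP// mdistxx.
  + have Ny : N y by apply: Nf; lra.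
    have [|w Nw wt] := Ndown y (- t) Ny; first by rewrite (fN _ Ny) in yt; apply/andP; split; lra.
    by exists w; rewrite // fN// wt opprK.
  + have Pz : P z by apply: Pf; lra.
    have [|w Pw wt] := Pdown z t Pz; first by rewrite (fP _ Pz) in tz; apply/andP; split; lra.
    by exists w; rewrite // fP.
Unshelve. all: by end_near. Qed.

(** Cutting the circle at [x] gives a coordinate from 0 to [t0 + t0]: out along [P] to [p], then
    back along [N]. Points of different arms are compared through [p]. *)
Lemma circle_chart (x p y : X) (P N : set X) :
  closed P -> closed N -> P x -> N x -> P p -> N p -> 0 < mdist x p ->
  (forall z, P z \/ N z) ->
  (forall z, P z -> N z -> z <> x -> mdist x p <= mdist x z) ->
  (forall z, mdist x z <= mdist x p) ->
  (forall y z, P y -> P z -> mdist y z = `|mdist x y - mdist x z|) ->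
  (forall y z, N y -> N z -> mdist y z = `|mdist x y - mdist x z|) ->
  (forall y s, P y -> 0 <= s <= mdist x y -> exists2 w, P w & mdist x w = s) ->
  (forall y s, N y -> 0 <= s <= mdist x y -> exists2 w, N w & mdist x w = s) ->
  y <> x -> chart_around y.
Proof.
set t0 := mdist x p => cP cN Px Nx Pp Np t0_gt0 PN p_min t_max Piso Niso Pdown Ndown yx.
pose f y : R := if `[< P y >] then mdist x y else t0 + t0 - mdist x y.
have fP z : P z -> f z = mdist x z by move=> Pz; rewrite /f asboolT.
have fN z : z <> x -> N z -> f z = t0 + t0 - mdist x z.
  move=> zx Nz; rewrite /f; case: ifPn => // /asboolP Pz.
  (* A common point other than [x] is at distance [t0], where the two formulas agree. *)
  by have := p_min _ Pz Nz zx; have := t_max z; lra.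
have pos z : z <> x -> 0 < mdist x z.
  by move=> zx; rewrite mdist_gt0; apply/eqP => /esym.
have [w Pw wt] := Pdown p (t0 / 2) Pp (ltac:(apply/andP; split; rewrite -/t0; lra)).
have wx : w <> x by move=> wx; move: wt; rewrite wx mdistxx; lra.
have px : p <> x by move=> px; move: t0_gt0; rewrite /t0 px mdistxx ltxx.
have oU : open [set z | z <> x].
  have -> : [set z | z <> x] = ~` [set x] by [].
  by rewrite openC; exact/accessible_closed_set1/hausdorff_accessible/metric_hausdorff.
have [q Uq qy] : exists2 q, q <> x & q <> y.
  have [->|/eqP yp] := eqVneq y p; last by exists p => // /esym.
  by exists w => // wp; move: wt; rewrite wp -/t0; lra.
have dpz z u : P z -> N u -> mdist z u <= (t0 - mdist x z) + (t0 - mdist x u).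
  move=> Pz Nu; have := metric_triangle z p u.
  rewrite (Piso z p)// (Niso p u)// -/t0 distrC !ger0_norm ?subr_ge0//.
apply: (@interval_chart _ _ [set z | z <> x] f y q) => //.
- move=> z zx; apply: (@closed_pasting _ _ P N f (mdist x) (fun z => t0 + t0 - mdist x z)) => //.
  + exact: mdist_continuous.
  + by apply: continuousB; [exact: cst_continuous|exact: mdist_continuous].
  + by near=> u; exact: fP.
  + near=> u; apply: fN; near: u; exact: open_nbhs_nbhs.
- move=> z u zx ux; have [Pz|Nz] := PN z; have [Pu|Nu] := PN u.
  + by rewrite !fP// Piso.
  + have := dpz z u Pz Nu; rewrite fP// fN//; have := t_max z; have := t_max u.
    by move=> h1 h2 h3; rewrite ler0_norm; lra.
  + have := dpz u z Pu Nz; rewrite fN// fP// metric_sym; have := t_max z; have := t_max u.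
    by move=> h1 h2 h3; rewrite ger0_norm; lra.
  + rewrite !fN// Niso// distrC le_eqVlt; apply/orP; left; apply/eqP.
    by congr Num.norm; lra.
- move=> _ _ [z zx <-] [u ux <-] t /andP[zt tu].
  have t_pos : 0 < t.
    apply: lt_le_trans zt; have [Pz|Nz] := PN z; first by rewrite fP// pos.
    by rewrite fN//; have := t_max z; lra.
  have t_lt : t < t0 + t0.
    apply: le_lt_trans tu _; have [Pu|Nu] := PN u.
      by rewrite fP//; have := t_max u; lra.
    by rewrite fN//; have := pos u ux; lra.
  have [tt|tt] := lerP t t0.
    have [|v Pv vt] := Pdown p t Pp; first by rewrite -/t0; apply/andP; split; lra.
    exists v; last by rewrite fP.
    by move=> vx; move: vt; rewrite vx mdistxx; lra.
  have [|v Nv vt] := Ndown p (t0 + t0 - t) Np; first by rewrite -/t0; apply/andP; split; lra.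
  have vx : v <> x by move=> vx; move: vt; rewrite vx mdistxx; lra.
  by exists v; rewrite // fN// vt; lra.
Unshelve. all: by end_near. Qed.

End LocalCharts.

(** * Interval or circle, according to whether the arms meet again *)

Theorem theorem3p1 (R : realType) (X : completeMetricType R)
    (m : {measure set (borel X) -> \bar R})
    (hX : metric_measure_space m)
    (h1 : forall mu0 mu1 : probability (borel X) R, P2ac m mu0 -> P2 mu1 ->
       exists2 pi, OptGeo mu0 mu1 pi & induced_by_map mu0 pi)
    (h2 : exists (x : X) (r : R) (I : set R),
       [/\ 0 < r, open I, is_interval I &
           isometric_sets (ball x r) (I : set R^o)]) :
  manifold1_with_boundary R X.
Proof.
have [_ sepX _ m_lf m_supp] := hX.
have [x [r0 [I [r0_gt0 oI _ isoI]]]] := h2.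
have [r [g gB]] := ball_chart_of_isometry r0_gt0 oI isoI.
have gB' := ball_chart_opp gB; have [r_gt0 g0 giso _] := gB.
split; [exact: metric_hausdorff|exact: separable_second_countable|move=> p].
have [->|/eqP px] := eqVneq p x; first exact: ball_chart_center gB.
pose P : set X := arm x g (r / 4); pose N : set X := arm x (g \o -%R) (r / 4).
have PN z : P z \/ N z := arms_cover m_lf m_supp h1 z gB.
have [Px cP Piso Pinj Pdown] := chart_arm m_lf m_supp h1 gB.
have [Nx cN Niso Ninj Ndown] := chart_arm m_lf m_supp h1 gB'.
(* Up to distance [r / 4] the arms are opposite halves of the chart, which share only [x]. *)
have far z : P z -> N z -> z <> x -> r / 4 < mdist x z.
  move=> [a [_ az ak]] [b [_ bz bk]] zx; rewrite ltNge; apply/negP => zr.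
  have z0 : 0 <= mdist x z <= r / 4 by rewrite mdist_ge0.
  have zg : z = g (mdist x z) by rewrite -ak// az.
  have zg' : z = g (- mdist x z) by rewrite -[RHS]/((g \o -%R) _) -bk// bz.
  have zr' : `|mdist x z| < r by rewrite ger0_norm ?mdist_ge0//; lra.
  have := giso _ (- mdist x z) zr'; rewrite normrN -zg -zg' mdistxx opprK => /(_ zr').
  rewrite ger0_norm ?addr_ge0 ?mdist_ge0// => xz.
  by apply/zx/esym/mdist_positivity; lra.
have [[c [Pc Nc cx]]|noC] := pselect (exists c, [/\ P c, N c & c <> x]); last first.
  apply: (line_chart cP cN Px Nx PN _ Piso Niso Pdown Ndown px) => z Pz Nz.
  by apply: contrapT => zx; apply: noC; exists z.
pose C := [set mdist x z | z in [set z | [/\ P z, N z & z <> x]]].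
have C_inf : has_inf C.
  split; first by exists (mdist x c), c.
  by exists (r / 4) => _ [z [Pz Nz zx] <-]; rewrite ltW// far.
have C_lb z : P z -> N z -> z <> x -> inf C <= mdist x z.
  by move=> Pz Nz zx; apply: ge_inf; [exact: C_inf.2|exists z].
have inf_lb : r / 4 <= inf C.
  by apply: lb_le_inf; [exact: C_inf.1|move=> _ [z [Pz Nz zx] <-]; rewrite ltW// far].
have [|q Pq qE] := Pdown c (inf C) Pc; first by rewrite C_lb// andbT; lra.
(* The infimum is attained: common points whose distances tend to [inf C] converge to [q] along [P],
   and [N] is closed. *)
have Nq : N q.
  apply: cN => W /nbhs_ballP[e /= e0 eW].
  have [_ [z [Pz Nz zx] <-] ze] := inf_adherent e0 C_inf.
  exists z; split=> //; apply: eW; rewrite ballEmdist /= Piso// qE distrC.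
  by rewrite ger0_norm; have := C_lb z Pz Nz zx; lra.
have q_min z : P z -> N z -> z <> x -> mdist x q <= mdist x z by rewrite qE; exact: C_lb.
have q_far : r / 4 <= mdist x q by rewrite qE.
(* Both arms end at [q]: the absence of a tail is used once for each arm. *)
have q_max z : mdist x z <= mdist x q.
  have [Pz|Nz] := PN z.
    exact: (no_tail m_lf m_supp h1 gB gB' PN Pq Nq).
  apply: (no_tail m_lf m_supp h1 gB' gB _ Nq Pq) => // [w|w Nw Pw].
    by have [] := PN w; [right|left].
  exact: q_min.
apply: (circle_chart cP cN Px Nx Pq Nq _ PN q_min q_max Piso Niso Pdown Ndown px).
by rewrite qE; lra.
Qed.
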